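(* Fix $k\ge4$. Let $p,q$ be positive integers with $p+q=m-1$ and $|p-q|\le1$. Then $C_3(p,q)$ is a hypergraph with the smallest spectral radius in $\mathscr{B}_3(m)$.
   Context: A $k$-graph is a simple $k$-uniform hypergraph; $\rho(H)$ is the spectral radius of its adjacency tensor (order $k$, entries $1/(k-1)!$ at index tuples forming an edge, $0$ otherwise; $\rho$ the maximal modulus of eigenvalues $\lambda$ with $\mathcal{A}x=\lambda x^{[k-1]}$, $x\neq0$). Cyclomatic number of a $k$-graph with $n$ vertices, $m$ edges, $p$ components: $m(k-1)-n+p$; bicyclic means connected with cyclomatic number 2; $\mathscr{B}(m)$ is the set of bicyclic $k$-graphs with $m$ edges. A pendant edge is an edge containing at least $k-1$ vertices of degree 1; the base of a bicyclic $G$ is its unique minimal bicyclic sub-hypergraph, obtained by repeatedly deleting pendant edges. Joining distinct vertices $a,b$ by a loose path of length $n\ge1$ means adding new edges $f_1,\dots,f_n$ with $a\in f_1$, $b\in f_n$, $|f_i\cap f_{i+1}|=1$, $f_i\cap f_j=\emptyset$ for $|i-j|\ge2$, all other vertices new. Let $e$ be a $k$-set with distinct vertices $u_1,u_2,v_1,v_2\in e$ (so $k\ge4$); $C_3(n_1,n_2)$ ($n_1,n_2\ge1$) is obtained from $e$ by joining $u_1,u_2$ by a loose path of length $n_1$ and $v_1,v_2$ by one of length $n_2$. A $k$-graph is $\Theta^*$-type if isomorphic to some $C_3(n_1,n_2)$. $\mathscr{B}_3(m)$ is the set of $G\in\mathscr{B}(m)$ whose base is $\Theta^*$-type. *)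

(* Defs.v *)
From HB Require Import structures.
From mathcomp Require Import all_boot all_order all_algebra.
From mathcomp Require Import classical_sets reals.
From mathcomp Require Import complex.

Set Implicit Arguments.
Unset Strict Implicit.
Unset Printing Implicit Defensive.

Import Order.TTheory GRing.Theory Num.Theory.

(* Simple finite hypergraphs; [k]-graphs are those satisfying [uniform k]. *)
Record hypergraph := Hypergraph {
  vertices : finType;
  edges : {set {set vertices}}
}.

Definition uniform (k : nat) (H : hypergraph) : Prop :=
  forall e : {set vertices H}, e \in edges H -> #|e| = k.

Definition isomorphic (H G : hypergraph) : Prop :=
  exists2 f : vertices H -> vertices G,
    bijective f & edges G = [set f @: (e : {set vertices H}) | e in edges H].

Section Connectivity.

Definition adjacent (H : hypergraph) : rel (vertices H) :=
  [rel x y | [exists e in edges H, (x \in e) && (y \in e)]].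
Arguments adjacent H : clear implicits.

Definition connected (H : hypergraph) : Prop :=
  forall x y : vertices H, connect (adjacent H) x y.

(* Isolated vertices count as components. *)
Definition ncomponents (H : hypergraph) : nat :=
  n_comp (adjacent H) (vertices H).

Definition cyclomatic (k : nat) (H : hypergraph) : int :=
  ((#|edges H| * (k - 1))%N%:Z - #|vertices H|%:Z + (ncomponents H)%:Z)%R.

Definition bicyclic (k : nat) (H : hypergraph) : Prop :=
  [/\ uniform k H, connected H & cyclomatic k H = 2%R].

End Connectivity.

Section Base.

Definition is_sub (H : hypergraph)
    (W : {set vertices H}) (F : {set {set vertices H}}) : Prop :=
  F \subset edges H /\ forall e : {set vertices H}, e \in F -> e \subset W.

Definition sub_hypergraph (H : hypergraph)
    (W : {set vertices H}) (F : {set {set vertices H}}) : hypergraph :=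
  @Hypergraph {x : vertices H | x \in W}
    [set val @^-1: (e : {set vertices H}) | e in F].

(* [(W, F)] is a minimal bicyclic sub-hypergraph of [H]. For bicyclic [H] it is
   unique, and is what remains once pendant edges (together with their vertices
   of degree 1) have been deleted as long as possible. *)
Definition is_base (k : nat) (H : hypergraph)
    (W : {set vertices H}) (F : {set {set vertices H}}) : Prop :=
  [/\ is_sub W F, bicyclic k (sub_hypergraph W F) &
      forall (W' : {set vertices H}) (F' : {set {set vertices H}}),
        is_sub W' F' -> bicyclic k (sub_hypergraph W' F') ->
        W' \subset W -> F' \subset F -> W' = W /\ F' = F].

End Base.

Section ThetaStar.

(* A loose path of [n] edges of size [k] from [a] to [b] is laid out along a
   sequence of [n * (k - 1) + 1] vertices, the [i]-th edge (from 0) occupying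
   the positions [i * (k - 1), ..., (i + 1) * (k - 1)]. Position 0 is [a], the
   last one is [b], and the [n * (k - 1) - 1] others are new vertices. *)
Definition path_vertex (k : nat) (V : finType) (a b : V) (n j : nat) :
    V + 'I_(n * (k - 1) - 1) :=
  if j is j'.+1 then oapp inr (inl b) (insub j') else inl a.

Definition path_edge (k : nat) (V : finType) (a b : V) (n i : nat) :
    {set V + 'I_(n * (k - 1) - 1)} :=
  [set path_vertex k a b n (i * (k - 1) + j) | j : 'I_k].

Definition join_path (k : nat) (H : hypergraph) (a b : vertices H) (n : nat) :
    hypergraph :=
  @Hypergraph (vertices H + 'I_(n * (k - 1) - 1))%type
    ([set inl @: (e : {set vertices H}) | e in edges H]
       :|: [set path_edge k a b n i | i : 'I_n]).

Definition single_edge (k : nat) : hypergraph :=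
  @Hypergraph 'I_k [set [set: 'I_k]].

(* Meant for distinct [u1, u2, v1, v2] and [n1, n2 >= 1]. *)
Definition C3 (k : nat) (u1 u2 v1 v2 : 'I_k) (n1 n2 : nat) : hypergraph :=
  let H := @join_path k (single_edge k) u1 u2 n1 in
  @join_path k H (inl v1 : vertices H) (inl v2 : vertices H) n2.

Definition theta_star (k : nat) (H : hypergraph) : Prop :=
  exists (u1 u2 v1 v2 : 'I_k) (n1 n2 : nat),
    [/\ uniq [:: u1; u2; v1; v2], 0 < n1, 0 < n2 &
        isomorphic H (C3 u1 u2 v1 v2 n1 n2)].

Definition in_B (k m : nat) (G : hypergraph) : Prop :=
  bicyclic k G /\ #|edges G| = m.

Definition in_B3 (k m : nat) (G : hypergraph) : Prop :=
  in_B k m G /\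
  exists (W : {set vertices G}) (F : {set {set vertices G}}),
    is_base k W F /\ theta_star k (sub_hypergraph W F).

End ThetaStar.

Section SpectralRadius.

Local Open Scope ring_scope.
Local Open Scope complex_scope.

(* A tensor of order [r.+1] indexed by [V], its first index being separate. *)
Definition tensor (C : Type) (V : finType) (r : nat) : Type :=
  V -> r.-tuple V -> C.

Definition tensor_mul (C : comNzRingType) (V : finType) (r : nat)
    (A : tensor C V r) (x : {ffun V -> C}) (v : V) : C :=
  \sum_(t : r.-tuple V) A v t * \prod_(w <- t) x w.

Definition tensor_eigenvalue (C : comNzRingType) (V : finType) (r : nat)
    (A : tensor C V r) (lambda : C) : Prop :=
  exists2 x : {ffun V -> C},
    x != 0 & forall v : V, tensor_mul A x v = lambda * x v ^+ r.

Definition adjacency_tensor (R : realType) (k : nat) (H : hypergraph) :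
    tensor R[i] (vertices H) (k - 1) :=
  fun v t =>
    if [set w in v :: t] \in edges H then ((k - 1)`!%:R)^-1 else 0.
Arguments adjacency_tensor R k H : clear implicits.

(* The tensor has finitely many eigenvalues, so [sup] is a maximum here. *)
Definition spectral_radius (R : realType) (k : nat) (H : hypergraph) : R :=
  sup [set r : R | exists2 lambda : R[i],
         tensor_eigenvalue (adjacency_tensor R k H) lambda
         & `|lambda| = r%:C]%classic.

End SpectralRadius.

(* Main.v *)
Require Import Defs.
From HB Require Import structures.
From mathcomp Require Import all_boot all_order all_algebra.
From mathcomp Require Import classical_sets reals.
From mathcomp Require Import complex.
From mathcomp Require Import topology normedtype derive realfun exp.
From mathcomp Require Import zify ring lra.
From mathcomp Require Import fintype finset.

Set Implicit Arguments.
Unset Strict Implicit.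
Unset Printing Implicit Defensive.

Import Order.TTheory GRing.Theory Num.Theory.
Import numFieldNormedType.Exports.

(* The [k]-th powers of the entries of the Perron vector of [C3 n1 n2] can be
   written down. Put [s = r ^ (k/2)] and let [h] be the [(k/2)]-th powers of
   the entries at the vertices where consecutive path edges meet; eliminating
   the degree-1 vertices turns the eigenvalue equation along a path into
   [s h_i = h_(i-1) + h_(i+1)]. With [s = t + 1/t], [t > 1], the symmetric
   solution is [h_i ~ t^i + t^(n-i)], so that [s h_0 - h_1 = c_n h_0] with
   [c_n = (t^(n+2) + 1) / (t (t^n + 1))], and the equations at the core edge
   reduce to [c_n1 c_n2 = s]. Now [c_n] increases with [n] and, for fixed
   [n1 + n2], the product [c_n1 c_n2] is largest when [n1] and [n2] are
   balanced. Hence, if [r] solves the equation for a balanced pair [(p, q)],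
   the same recipe gives a vector with [A x >= r x^(k-1)] on every
   [C3 n1 n2] with [n1 + n2 <= p + q]. Every member of [B_3(m)] contains such
   a hypergraph; extending the vector by zero bounds its spectral radius from
   below, since the spectral radius is at least the maximum of the associated
   form on the unit sphere of the k-norm. *)

(** * Loose paths attached to a hypergraph *)

Lemma leq_mul2r_imp m n : m <= n -> forall K, m * K <= n * K.
Proof. by move=> mn K; rewrite leq_mul2r mn orbT. Qed.

Lemma path_vertex_last (k : nat) (V : finType) (a b : V) (n : nat) :
  1 < k -> 0 < n -> path_vertex k a b n (n * (k - 1)) = inl b.
Proof.
move=> k1 n0; have N0 : 0 < n * (k - 1) by rewrite muln_gt0 n0 subn_gt0.
have pvE l : 0 < l -> path_vertex k a b n l = oapp inr (inl b) (insub l.-1) by case: l.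
by rewrite pvE // insubF //; lia.
Qed.

Lemma path_vertex_new (k : nat) (V : finType) (a b : V) (n : nat)
    (j : 'I_(n * (k - 1) - 1)) :
  path_vertex k a b n j.+1 = inr j.
Proof. by rewrite /= valK. Qed.

Lemma path_vertex_inj (k : nat) (V : finType) (a b : V) (n : nat) :
  1 < k -> 0 < n -> a != b ->
  {in [pred l | l <= n * (k - 1)] &, injective (path_vertex k a b n)}.
Proof.
move=> k1 n0 ab l l'; rewrite !inE /path_vertex => ll ll'.
have N0 : 0 < n * (k - 1) by rewrite muln_gt0 n0 subn_gt0.
case: l ll => [|l] ll; case: l' ll' => [|l'] ll' //=.
- by case: insubP => //= _ [] ba; rewrite ba eqxx in ab.
- by case: insubP => //= _ [] ba; rewrite ba eqxx in ab.
case: insubP => [i _ <-|nl]; case: insubP => [i' _ <-|nl'] //=; first by case=> ->.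
(* Both positions lie beyond the new vertices, so both are the last position [n * (k - 1)], which is
   sent to [b]. *)
by move=> _; lia.
Qed.

Lemma path_position_le (k n i j : nat) :
  1 < k -> i < n -> j < k -> i * (k - 1) + j <= n * (k - 1).
Proof.
move=> k1 ni jk; apply: (@leq_trans (i.+1 * (k - 1))); last by rewrite leq_mul2r ni orbT.
by rewrite mulSn addnC leq_add2r; lia.
Qed.

Lemma path_edge_inj (k : nat) (V : finType) (a b : V) (n i : nat) :
  1 < k -> i < n -> a != b ->
  injective (fun j : 'I_k => path_vertex k a b n (i * (k - 1) + j)).
Proof.
move=> k1 ni ab j j' /path_vertex_inj jj'; apply/val_inj/(@addnI (i * (k - 1))).
by apply: jj' => //; rewrite ?inE ?path_position_le //; lia.
Qed.

Lemma card_path_edge (k : nat) (V : finType) (a b : V) (n i : nat) :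
  1 < k -> i < n -> a != b -> #|path_edge k a b n i| = k.
Proof. by move=> k1 ni ab; rewrite card_imset ?card_ord //; exact: path_edge_inj. Qed.

Lemma mem_path_edge (k : nat) (V : finType) (a b : V) (n i l : nat) :
  1 < k -> i < n -> a != b -> l <= n * (k - 1) ->
  (path_vertex k a b n l \in path_edge k a b n i) =
  (i * (k - 1) <= l <= i.+1 * (k - 1)).
Proof.
move=> k1 ni ab ll; apply/imsetP/andP => [[j _ /path_vertex_inj lj]|[l1 l2]].
  have -> : l = i * (k - 1) + j.
    by apply: lj; rewrite ?inE ?path_position_le //; lia.
  by rewrite leq_addr mulSn addnC leq_add2r; split => //; have := ltn_ord j; lia.
have lk : l - i * (k - 1) < k by move: l2; rewrite mulSn; lia.
by exists (Ordinal lk) => //=; rewrite subnKC.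
Qed.

Lemma inl_mem_path_edge (k : nat) (V : finType) (a b : V) (n i : nat) (v : V) :
  1 < k -> i < n -> a != b ->
  (inl v \in path_edge k a b n i) = (i == 0) && (v == a) || (i.+1 == n) && (v == b).
Proof.
move=> k1 ni ab; have n0 : 0 < n by lia.
have K0 : 0 < k - 1 by lia.
have [->|va] := eqVneq v a.
  have := mem_path_edge k1 ni ab (leq0n _) => /= ->.
  by rewrite leqn0 muln_eq0 [k - 1 == 0]eqn0Ngt K0 orbF (negbTE ab) !andbF orbF !andbT.
have [->|vb] := eqVneq v b.
  rewrite -(path_vertex_last a b k1 n0) mem_path_edge // !leq_pmul2r // (ltnW ni) /=.
  by rewrite andbF /= andbT eqn_leq ni.
rewrite !andbF; apply/imsetP => -[j _]; case: (i * _ + j) => [|l] /=.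
  by case=> va'; rewrite va' eqxx in va.
by case: insubP => //= _ [] vb'; rewrite vb' eqxx in vb.
Qed.

Lemma inr_mem_path_edge (k : nat) (V : finType) (a b : V) (n i : nat)
    (j : 'I_(n * (k - 1) - 1)) :
  1 < k -> i < n -> a != b ->
  (inr j \in path_edge k a b n i) = (i * (k - 1) <= j.+1 <= i.+1 * (k - 1)).
Proof.
move=> k1 ni ab; rewrite -(path_vertex_new a b) mem_path_edge //.
by have := ltn_ord j; lia.
Qed.

Lemma inl_mem_old_edge (V W : finType) (v : V) (e : {set V}) :
  ((inl v : V + W) \in inl @: e) = (v \in e).
Proof. by rewrite mem_imset //; exact: inl_inj. Qed.

Lemma inr_mem_old_edge (V W : finType) (j : W) (e : {set V}) :
  ((inr j : V + W) \in inl @: e) = false.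
Proof. by apply/imsetP => -[]. Qed.

Lemma path_edge_injective (k : nat) (V : finType) (a b : V) (n : nat) :
  2 < k -> a != b -> injective (fun i : 'I_n => path_edge k a b n i).
Proof.
move=> k2 ab i i' ii'; apply: ord_inj; have k1 : 1 < k by lia.
(* Since [k - 1 > 1], position [i * (k - 1) + 1] is interior to edge [i] and tells it apart from all
   other path edges. *)
have l1 : i * (k - 1) + 1 <= n * (k - 1) by apply: path_position_le.
have := mem_path_edge k1 (ltn_ord i) ab l1; rewrite ii' (mem_path_edge k1 (ltn_ord i') ab l1).
have K2 : 1 < k - 1 by lia.
move: (k - 1) K2 (nat_of_ord i) (nat_of_ord i') => K K2 c c'; rewrite !mulSn.
by case: (ltngtP c c') => [/leq_mul2r_imp/(_ K)|/leq_mul2r_imp/(_ K)|//]; rewrite mulSn; lia.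
Qed.

(** * Sums over all edges, and over the edges at a vertex, after joining a path *)

Lemma new_mem_path_edge (k : nat) (V : finType) (a b : V) (n i : nat) :
  2 < k -> i < n -> a != b -> exists j, inr j \in path_edge k a b n i.
Proof.
move=> k2 ni ab; have k1 : 1 < k by lia.
have l1 : i * (k - 1) < n * (k - 1) - 1.
  by apply: (@leq_trans (i * (k - 1) + 2 - 1)); [lia|rewrite leq_sub2r // path_position_le].
by exists (Ordinal l1); rewrite inr_mem_path_edge //=; rewrite mulSn; lia.
Qed.

(** Every path edge has a new vertex, so old edges and path edges never coincide. The operation is
    left general because the decomposition serves both counts in [nat] and sums in [R]. *)
Lemma big_join_path_edges (T : Type) (idx : T) (op : Monoid.com_law idx)
    (k : nat) (H : hypergraph) (a b : vertices H) (n : nat)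
    (F : {set vertices (join_path k a b n)} -> T) :
  2 < k -> a != b ->
  \big[op/idx]_(e in edges (join_path k a b n)) F e =
  op (\big[op/idx]_(e in edges H) F (inl @: e))
     (\big[op/idx]_(i < n) F (path_edge k a b n i)).
Proof.
move=> k2 ab /=; set A := (X in X :|: _); set B := (X in _ :|: X).
have dAB : [disjoint A & B].
  rewrite -setI_eq0; apply/eqP/setP => e; rewrite !inE.
  apply/negP => /andP[/imsetP[e' _ ->] /imsetP[i _ ei]].
  have [j] := new_mem_path_edge k2 (ltn_ord i) ab.
  by rewrite -ei inr_mem_old_edge.
rewrite (eq_bigl [in [predU A & B]]); last by move=> e; rewrite in_setU.
rewrite bigU //; congr (op _ _); rewrite big_imset //=.
  by move=> e e' _ _; exact: (imset_inj inl_inj).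
by move=> i i' _ _; exact: path_edge_injective.
Qed.

Lemma big_path_edge (T : Type) (idx : T) (op : Monoid.com_law idx)
    (k : nat) (V : finType) (a b : V) (n i : nat)
    (F : V + 'I_(n * (k - 1) - 1) -> T) :
  1 < k -> i < n -> a != b ->
  \big[op/idx]_(w in path_edge k a b n i) F w =
  \big[op/idx]_(j < k) F (path_vertex k a b n (i * (k - 1) + j)).
Proof.
by move=> k1 ni ab; rewrite big_imset //= => j j' _ _; exact: path_edge_inj.
Qed.

(** As [a != b], at most one conditional is active, so the formula also holds for [n = 1], where the
    first and the last path edge are the same. *)
Lemma big_incident_old (T : Type) (idx : T) (op : Monoid.com_law idx)
    (k : nat) (H : hypergraph) (a b : vertices H) (n : nat)
    (F : {set vertices (join_path k a b n)} -> T) (v : vertices H) :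
  2 < k -> 0 < n -> a != b ->
  \big[op/idx]_(e in edges (join_path k a b n) | inl v \in e) F e =
  op (\big[op/idx]_(e in edges H | v \in e) F (inl @: e))
     (op (if v == a then F (path_edge k a b n 0) else idx)
         (if v == b then F (path_edge k a b n n.-1) else idx)).
Proof.
move=> k2 n0 ab; have k1 := ltnW k2.
rewrite big_mkcondr (big_join_path_edges _ _ k2 ab) [in RHS]big_mkcondr /=.
congr (op _ _); first by apply: eq_bigr => e _; rewrite inl_mem_old_edge.
rewrite (eq_bigr (fun i : 'I_n => op (if (i == 0 :> nat) && (v == a) then F (path_edge k a b n i) else idx)
   (if (i.+1 == n) && (v == b) then F (path_edge k a b n i) else idx))); last first.
  move=> i _; rewrite inl_mem_path_edge //.
  have [->|va] := eqVneq v a; first by rewrite (negbTE ab) !andbF orbF /= [RHS]Monoid.mulm1.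
  by rewrite !andbF orFb [RHS]Monoid.mul1m.
rewrite big_split /=; congr (op _ _).
  case: ifP => _; last by rewrite big1 // => i _; rewrite andbF.
  rewrite (bigD1 (Ordinal n0)) //= big1 ?Monoid.mulm1 // => i.
  by rewrite -val_eqE /= andbT => /negbTE ->.
case: ifP => _; last by rewrite big1 // => i _; rewrite andbF.
have nn : n.-1 < n by rewrite prednK.
rewrite (bigD1 (Ordinal nn)) //= prednK // eqxx big1 ?Monoid.mulm1 // => i.
by rewrite -val_eqE /= andbT => ni; rewrite ifF //; lia.
Qed.

(** The vertex [inr j] sits at position [j.+1]. A multiple of [k - 1] is a link vertex shared by the
    edges [c.-1] and [c], and then [c > 0]; any other position is interior to edge [c]. *)
Lemma big_incident_new (T : Type) (idx : T) (op : Monoid.com_law idx)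
    (k : nat) (H : hypergraph) (a b : vertices H) (n : nat)
    (F : {set vertices (join_path k a b n)} -> T) (j : 'I_(n * (k - 1) - 1)) :
  2 < k -> a != b ->
  \big[op/idx]_(e in edges (join_path k a b n) | inr j \in e) F e =
  let c := j.+1 %/ (k - 1) in
  if k - 1 %| j.+1 then op (F (path_edge k a b n c.-1)) (F (path_edge k a b n c))
  else F (path_edge k a b n c).
Proof.
move=> k2 ab; have k1 := ltnW k2; have K0 : 0 < k - 1 by rewrite subn_gt0.
have jn := ltn_ord j; set c := j.+1 %/ (k - 1).
have cn : c < n by rewrite ltn_divLR //; lia.
rewrite big_mkcondr (big_join_path_edges _ _ k2 ab) /= big1 ?Monoid.mul1m; last first.
  by move=> e _; rewrite inr_mem_old_edge.
rewrite -big_mkcond /=.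
rewrite (eq_bigl (fun i : 'I_n => (i == c :> nat) || (k - 1 %| j.+1) && (i.+1 == c))); last first.
  move=> i; rewrite inr_mem_path_edge // -leq_divRL // -/c.
  have := divn_eq j.+1 (k - 1); rewrite -/c => jE.
  have := ltn_pmod j.+1 K0; rewrite /dvdn; move: (j.+1 %% _) jE => d jE dK.
  rewrite jE; have [->|ic] := eqVneq (i : nat) c.
    by rewrite leqnn /= mulSn; apply/idP; lia.
  rewrite /=; case: (ltngtP i.+1 c) => ic'; last 1 first.
  - by rewrite -ic'; lia.
  - by rewrite andbF; have /leq_mul2r_imp/(_ (k - 1)) := ic'; rewrite mulSn; lia.
  - by rewrite andbF; lia.
case: ifP => jc; last first.
  by rewrite (big_pred1 (Ordinal cn)) // => i; rewrite orbF.
have c0 : 0 < c by rewrite divn_gt0 // dvdn_leq.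
have cn' : c.-1 < n by lia.
rewrite (bigD1 (Ordinal cn')) /=; last by rewrite prednK // eqxx orbT.
congr (op _ _); rewrite (big_pred1 (Ordinal cn)) // => i.
rewrite /= -[i == Ordinal cn']val_eqE /=; apply/idP/idP => [|/eqP ->]; last by rewrite /= eqxx /=; lia.
by move=> h; apply/eqP/ord_inj => /=; lia.
Qed.

(** * Bicyclic hypergraphs and the minimality of the base *)

Lemma adjacent_sym (H : hypergraph) : symmetric (@adjacent H).
Proof. by move=> x y; apply: eq_existsb => e; rewrite [(x \in e) && _]andbC. Qed.

Lemma connect_adjacent_sym (H : hypergraph) : connect_sym (@adjacent H).
Proof. exact/sym_connect_sym/adjacent_sym. Qed.

(** The right-hand side is a boolean read as a number: the hypergraph without vertices is connected
    too, but has no component. *)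
Lemma ncomponents_connected (H : hypergraph) :
  Defs.connected H -> ncomponents H = (0 < #|vertices H|).
Proof.
move=> cH; rewrite /ncomponents; case: posnP => [/eqP V0|/card_gt0P[x _]].
  by apply/eqP; rewrite -leqn0 -(eqP V0) subset_leq_card //; apply/subsetP.
rewrite -[RHS](n_comp_connect (@connect_adjacent_sym H) x); apply: eq_n_comp_r => y.
by symmetry; exact: cH x y.
Qed.

Lemma connect_transfer (T T' : finType) (e : rel T) (e' : rel T') (f : T -> T') :
  (forall x y, e x y -> e' (f x) (f y)) ->
  forall x y, connect e x y -> connect e' (f x) (f y).
Proof.
move=> ef x y /connectP[p]; elim: p x => [|z p IH] x /=; first by move=> _ ->; exact: connect0.
by case/andP=> /ef exz pz /(IH _ pz); apply: connect_trans; exact: connect1.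
Qed.

Lemma isomorphic_card_vertices (H G : hypergraph) :
  isomorphic H G -> #|vertices H| = #|vertices G|.
Proof. by case=> f bf _; exact: bij_eq_card bf. Qed.

Lemma isomorphic_card_edges (H G : hypergraph) :
  isomorphic H G -> #|edges H| = #|edges G|.
Proof. by case=> f bf ->; rewrite card_imset //; exact: imset_inj (bij_inj bf). Qed.

Lemma isomorphic_bicyclic (k : nat) (H G : hypergraph) :
  isomorphic H G -> bicyclic k G -> bicyclic k H.
Proof.
move=> iso [uG cG cyG]; have [f [g fK gK] EG] := iso.
have cH : Defs.connected H.
  move=> x y; rewrite -(fK x) -(fK y).
  apply: (connect_transfer _ (cG (f x) (f y))) => z w /existsP[e /and3P[]].
  rewrite EG => /imsetP[e' e'H ->] /imsetP[z' z'e ->] /imsetP[w' w'e ->].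
  by apply/existsP; exists e'; rewrite e'H !fK z'e.
split=> //.
  move=> e eH; rewrite -(card_imset _ (can_inj fK)); apply: uG.
  by rewrite EG; apply/imsetP; exists e.
move: cyG; rewrite /cyclomatic !ncomponents_connected //.
by rewrite (isomorphic_card_vertices iso) (isomorphic_card_edges iso).
Qed.

(** Edges in [F] stay inside [W], so restricting them loses nothing; counts and sums over the edges
    of the sub-hypergraph can thus be taken over [F]. *)
Lemma preimset_val_inj (H : hypergraph) (W : {set vertices H})
    (F : {set {set vertices H}}) :
  is_sub W F ->
  {in F &, injective (fun e : {set vertices H} => val @^-1: e : {set {x | x \in W}})}.
Proof.
case=> _ FW e e' eF e'F ee'; apply/setP => x.
have [xW|xW] := boolP (x \in W).
  by have := congr1 (fun A : {set _} => (Sub x xW : {x | x \in W}) \in A) ee'; rewrite !inE.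
have out A : A \in F -> (x \in A) = false.
  by move=> /FW/subsetP/(_ x) Ax; apply: contraNF xW.
by rewrite !out.
Qed.

Lemma card_sub_hypergraph_edges (H : hypergraph) (W : {set vertices H})
    (F : {set {set vertices H}}) :
  is_sub W F -> #|edges (sub_hypergraph W F)| = #|F|.
Proof. by move=> sWF; rewrite card_in_imset //; exact: preimset_val_inj. Qed.

Lemma isomorphic_sub_hypergraphT (H : hypergraph) :
  isomorphic (sub_hypergraph [set: vertices H] (edges H)) H.
Proof.
pose g (x : vertices H) : {x | x \in [set: vertices H]} := Sub x (in_setT x).
have gK : cancel g val by [].
exists val; first by exists g => // x; exact: val_inj.
rewrite -imset_comp -[LHS]imset_id; apply: eq_imset => e /=.
apply/setP => x; apply/idP/imsetP => [xe|[y ye ->]]; last by rewrite inE in ye.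
by exists (g x); rewrite ?inE.
Qed.

Lemma uniform_join_path (k : nat) (H : hypergraph) (a b : vertices H) (n : nat) :
  1 < k -> a != b -> uniform k H -> uniform k (join_path k a b n).
Proof.
move=> k1 ab uH e /setUP[/imsetP[e' /uH e'k ->]|/imsetP[i _ ->]].
  by rewrite card_imset //; exact: inl_inj.
by rewrite card_path_edge.
Qed.

Lemma connected_join_path (k : nat) (H : hypergraph) (a b : vertices H) (n : nat) :
  1 < k -> 0 < n -> a != b -> Defs.connected H -> Defs.connected (join_path k a b n).
Proof.
move=> k1 n0 ab cH; set J := join_path k a b n.
have old x y : connect (@adjacent J) (inl x) (inl y).
  apply: (connect_transfer _ (cH x y)) => z w /existsP[e /and3P[eH ze we]].
  apply/existsP; exists (inl @: e); rewrite !inl_mem_old_edge ze we !andbT.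
  by apply/setUP; left; apply/imsetP; exists e.
have new l : l <= n * (k - 1) -> connect (@adjacent J) (inl a) (path_vertex k a b n l).
  elim: l => [|l IH] ln; first exact: connect0.
  apply: connect_trans (IH (ltnW ln)) (connect1 _).
  (* Positions [l] and [l.+1] both lie in the path edge with index [l %/ (k - 1)]. *)
  have cn : l %/ (k - 1) < n by rewrite ltn_divLR //; lia.
  apply/existsP; exists (path_edge k a b n (l %/ (k - 1))); apply/and3P; split.
  - by apply/setUP; right; apply/imsetP; exists (Ordinal cn).
  - rewrite mem_path_edge ?(ltnW ln) // leq_trunc_div /=.
    by apply: ltnW; apply: ltn_ceil; lia.
  - rewrite mem_path_edge // (leq_trans (leq_trunc_div l _)) //=.
    by apply: ltn_ceil; lia.
have all_a w : connect (@adjacent J) (inl a) w.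
  case: w => [x|j]; first exact: old.
  by rewrite -(path_vertex_new a b); apply: new; have := ltn_ord j; lia.
move=> x y; apply: connect_trans (all_a y).
by rewrite connect_adjacent_sym.
Qed.

(** * Counting vertices, edges and incidences of [C3] *)

Lemma card_join_path_edges (k : nat) (H : hypergraph) (a b : vertices H) (n : nat) :
  2 < k -> a != b -> #|edges (join_path k a b n)| = #|edges H| + n.
Proof.
move=> k2 ab; rewrite -!sum1_card (big_join_path_edges _ _ k2 ab).
by congr (_ + _); rewrite big_const_ord iter_addn_0 mul1n.
Qed.

Lemma card_join_path_vertices (k : nat) (H : hypergraph) (a b : vertices H) (n : nat) :
  #|vertices (join_path k a b n)| = #|vertices H| + (n * (k - 1) - 1).
Proof. by rewrite card_sum card_ord. Qed.

(** As [C3] nests two joins, its vertices have the forms [inl (inl v)] in the core edge,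
    [inl (inr j)] on the first path and [inr j] on the second. *)
Definition C3_core_edge (k : nat) (u1 u2 v1 v2 : 'I_k) (p q : nat) :
    {set vertices (C3 u1 u2 v1 v2 p q)} :=
  inl @: (inl @: [set: 'I_k]).

Definition C3_left_edge (k : nat) (u1 u2 v1 v2 : 'I_k) (p q i : nat) :
    {set vertices (C3 u1 u2 v1 v2 p q)} :=
  inl @: path_edge k u1 u2 p i.

Definition C3_right_edge (k : nat) (u1 u2 v1 v2 : 'I_k) (p q i : nat) :
    {set vertices (C3 u1 u2 v1 v2 p q)} :=
  path_edge k (inl v1) (inl v2) q i.

Lemma big_C3_edges (T : Type) (idx : T) (op : Monoid.com_law idx)
    (k : nat) (u1 u2 v1 v2 : 'I_k) (p q : nat)
    (F : {set vertices (C3 u1 u2 v1 v2 p q)} -> T) :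
  2 < k -> u1 != u2 -> v1 != v2 ->
  \big[op/idx]_(e in edges (C3 u1 u2 v1 v2 p q)) F e =
  op (op (F (C3_core_edge u1 u2 v1 v2 p q))
         (\big[op/idx]_(i < p) F (C3_left_edge u1 u2 v1 v2 p q i)))
     (\big[op/idx]_(i < q) F (C3_right_edge u1 u2 v1 v2 p q i)).
Proof.
by move=> k2 uu vv; rewrite !big_join_path_edges // big_set1.
Qed.

Lemma big_incident_C3_core (T : Type) (idx : T) (op : Monoid.com_law idx)
    (k : nat) (u1 u2 v1 v2 : 'I_k) (p q : nat)
    (F : {set vertices (C3 u1 u2 v1 v2 p q)} -> T) (v : 'I_k) :
  2 < k -> 0 < p -> 0 < q -> u1 != u2 -> v1 != v2 ->
  \big[op/idx]_(e in edges (C3 u1 u2 v1 v2 p q) | inl (inl v) \in e) F e =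
  op (op (F (C3_core_edge u1 u2 v1 v2 p q))
         (op (if v == u1 then F (C3_left_edge u1 u2 v1 v2 p q 0) else idx)
             (if v == u2 then F (C3_left_edge u1 u2 v1 v2 p q p.-1) else idx)))
     (op (if v == v1 then F (C3_right_edge u1 u2 v1 v2 p q 0) else idx)
         (if v == v2 then F (C3_right_edge u1 u2 v1 v2 p q q.-1) else idx)).
Proof.
move=> k2 p0 q0 uu vv; rewrite !big_incident_old //.
by rewrite (big_pred1 [set: 'I_k]) // => e; rewrite in_set1 /=; case: eqP => [->|//]; rewrite inE.
Qed.

Lemma big_incident_C3_left (T : Type) (idx : T) (op : Monoid.com_law idx)
    (k : nat) (u1 u2 v1 v2 : 'I_k) (p q : nat)
    (F : {set vertices (C3 u1 u2 v1 v2 p q)} -> T) (j : 'I_(p * (k - 1) - 1)) :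
  2 < k -> 0 < q -> u1 != u2 -> v1 != v2 ->
  \big[op/idx]_(e in edges (C3 u1 u2 v1 v2 p q) | inl (inr j) \in e) F e =
  let c := j.+1 %/ (k - 1) in
  if k - 1 %| j.+1 then
    op (F (C3_left_edge u1 u2 v1 v2 p q c.-1)) (F (C3_left_edge u1 u2 v1 v2 p q c))
  else F (C3_left_edge u1 u2 v1 v2 p q c).
Proof.
move=> k2 q0 uu vv; rewrite big_incident_old // big_incident_new //=.
by rewrite !Monoid.mulm1.
Qed.

Lemma big_incident_C3_right (T : Type) (idx : T) (op : Monoid.com_law idx)
    (k : nat) (u1 u2 v1 v2 : 'I_k) (p q : nat)
    (F : {set vertices (C3 u1 u2 v1 v2 p q)} -> T) (j : 'I_(q * (k - 1) - 1)) :
  2 < k -> v1 != v2 ->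
  \big[op/idx]_(e in edges (C3 u1 u2 v1 v2 p q) | inr j \in e) F e =
  let c := j.+1 %/ (k - 1) in
  if k - 1 %| j.+1 then
    op (F (C3_right_edge u1 u2 v1 v2 p q c.-1)) (F (C3_right_edge u1 u2 v1 v2 p q c))
  else F (C3_right_edge u1 u2 v1 v2 p q c).
Proof. by move=> k2 vv; rewrite big_incident_new. Qed.

Lemma card_C3_edges (k : nat) (u1 u2 v1 v2 : 'I_k) (p q : nat) :
  2 < k -> u1 != u2 -> v1 != v2 -> #|edges (C3 u1 u2 v1 v2 p q)| = (p + q).+1.
Proof. by move=> k2 uu vv; rewrite !card_join_path_edges // cards1. Qed.

Lemma uniform_C3 (k : nat) (u1 u2 v1 v2 : 'I_k) (p q : nat) :
  1 < k -> u1 != u2 -> v1 != v2 -> uniform k (C3 u1 u2 v1 v2 p q).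
Proof.
move=> k1 uu vv; do 2![apply: uniform_join_path => //].
by move=> e /set1P ->; rewrite cardsT card_ord.
Qed.

Lemma bicyclic_C3 (k : nat) (u1 u2 v1 v2 : 'I_k) (p q : nat) :
  2 < k -> 0 < p -> 0 < q -> u1 != u2 -> v1 != v2 ->
  bicyclic k (C3 u1 u2 v1 v2 p q).
Proof.
move=> k2 p0 q0 uu vv; have k1 := ltnW k2.
have cC : Defs.connected (C3 u1 u2 v1 v2 p q).
  do 2![apply: connected_join_path => //].
  move=> x y; apply/connect1/existsP; exists setT.
  by rewrite !inE eqxx.
split => //; first exact: uniform_C3.
rewrite /cyclomatic ncomponents_connected // card_C3_edges //.
rewrite !card_join_path_vertices card_ord.
(* Positivity makes the truncated subtractions in the vertex count exact; the cyclomatic number is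
   then [(k - 1) - k + 2 + 1 = 2]. *)
have : 0 < p * (k - 1) by rewrite muln_gt0 p0 subn_gt0.
have : 0 < q * (k - 1) by rewrite muln_gt0 q0 subn_gt0.
by rewrite mulSn mulnDl; lia.
Qed.

(** * Overlap counting in sub-hypergraphs of [C3] *)

(* The term [c = 0] is [d 0] because [0.-1 = 0]: it stands for the overlap of
   path edge [0] with the core edge, which closes the path to a cycle. *)
Lemma cyclic_overlaps_bound (d : nat -> bool) (n : nat) :
  0 < n ->
  \sum_(c < n) (d c.-1 && d c) + d n.-1 <= \sum_(i < n) d i + [forall i : 'I_n, d i].
Proof.
case: n => // n _; elim: n => [|n IH] /=.
  rewrite !big_ord_recr !big_ord0 /= andbb leq_add2l.
  suff -> : [forall i : 'I_1, d i] = d 0 by [].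
  by apply/forallP/idP => [/(_ ord0) //|d0 i]; rewrite ord1.
rewrite big_ord_recr [X in _ <= X + _]big_ord_recr /=.
have -> : [forall i : 'I_n.+2, d i] = [forall i : 'I_n.+1, d i] && d n.+1.
  apply/forallP/andP => [dn|[/forallP dn dn1] i].
    by split; [apply/forallP => i; exact: (dn (widen_ord (leqnSn _) i))|exact: (dn ord_max)].
  have [ilt|ige] := ltnP i n.+1; first exact: (dn (Ordinal ilt)).
  by have -> : i = n.+1 :> nat by have := ltn_ord i; lia.
have : [forall i : 'I_n.+1, d i] -> d n by move=> /forallP/(_ ord_max).
by move: IH; case: [forall i, _] => /=; case: (d n) (d n.+1) => [] [] /=; lia.
Qed.

(** Cut the positions below [n * K] into [n] blocks of length [K]: only the first position of each
    block contributes. Position 0 is not a new vertex, so its term [G 0] is added by hand. *)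
Lemma sum_at_multiples (K n : nat) (G : nat -> nat) :
  0 < K -> 0 < n ->
  \sum_(j < n * K - 1) (if K %| j.+1 then G (j.+1 %/ K) else 0) + G 0 =
  \sum_(c < n) G c.
Proof.
move=> K0 n0; have nK : 0 < n * K by rewrite muln_gt0 n0.
pose phi l := if K %| l then G (l %/ K) else 0.
have -> : \sum_(j < n * K - 1) (if K %| j.+1 then G (j.+1 %/ K) else 0) + G 0 =
    \sum_(0 <= l < n * K) phi l.
  rewrite -[in RHS](prednK nK) big_nat_recl //= addnC -subn1 big_mkord.
  by rewrite {1}/phi dvdn0 div0n.
rewrite big_nat_mul big_mkord; apply: eq_bigr => c _.
rewrite mulSn addnC -{1}[c * K]add0n big_addn addKn big_mkord.
case: K K0 {nK} @phi => // K _ phi; rewrite big_ord_recl /= big1 => [|j _].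
  by rewrite /phi add0n dvdn_mull // mulnK // addn0.
by rewrite /phi dvdn_addl ?dvdn_mull // /bump /= add1n gtnNdvd // ltnS.
Qed.

(** Here [x], [aL], [aQ] say whether [F] contains the core edge, the whole left path, the whole
    right path; [SL], [SQ] count path edges in [F], [TL], [TQ] cyclic overlaps, [XL], [XQ] overlaps
    at new vertices. For [x = 1] the bounds combine to [FK + 1 <= cW + aL + aQ], and [cW < FK]
    forces [aL = aQ = 1]; for [x = 0] they give [FK <= cW], a contradiction. *)
Lemma overlap_count_saturated (x aL aQ l0 lp q0 qq SL SQ TL TQ XL XQ FK cF cW : nat) :
  x <= 1 -> aL <= 1 -> aQ <= 1 -> aL <= l0 -> aQ <= q0 ->
  cF = x + SL + SQ -> cW < FK ->
  FK + cF <= cW + (x * (l0 + lp + q0 + qq) + XL + XQ) ->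
  TQ + qq <= SQ + aQ -> TL + lp <= SL + aL -> XQ + q0 = TQ -> XL + l0 = TL ->
  [/\ x = 1, aL = 1, aQ = 1 & FK <= cW.+1].
Proof.
case: x => [|[|//]] _ aL1 aQ1 aLl aQq cE; rewrite ?mul0n ?mul1n; first lia.
by move=> *; split; lia.
Qed.

(** Cyclomatic number 2 with at most one component leaves a surplus of at least 1. This inequality
    is what the minimality argument uses. *)
Lemma bicyclic_sub_card (k : nat) (H : hypergraph) (W : {set vertices H})
    (F : {set {set vertices H}}) :
  is_sub W F -> bicyclic k (sub_hypergraph W F) -> #|W| < #|F| * (k - 1).
Proof.
move=> sWF [_ cS]; rewrite /cyclomatic ncomponents_connected //.
rewrite card_sub_hypergraph_edges // card_sig; set b := (0 < _).
have : b <= 1 by case: b.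
rewrite (eq_card (B := W)) //; lia.
Qed.

(* Each vertex of [C3] has degree at most 2, so [#|W|] is at least the number of
   incidences of [F] minus the number of pairs of edges of [F] that meet at a
   vertex; by the previous bounds the cyclomatic number 2 forces every edge. *)
Lemma C3_sub_bicyclic_full (k : nat) (u1 u2 v1 v2 : 'I_k) (p q : nat)
    (W : {set vertices (C3 u1 u2 v1 v2 p q)})
    (F : {set {set vertices (C3 u1 u2 v1 v2 p q)}}) :
  3 < k -> uniq [:: u1; u2; v1; v2] -> 0 < p -> 0 < q ->
  is_sub W F -> #|W| < #|F| * (k - 1) ->
  W = [set: vertices (C3 u1 u2 v1 v2 p q)] /\ F = edges (C3 u1 u2 v1 v2 p q).
Proof.
move=> k3 huv; move: (huv) => /= /and4P[]; rewrite !inE !negb_or.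
move=> /and3P[uu uv1 uv2] /andP[uv3 uv4] vv _ p0 q0 [FE FW] WF.
set C := C3 u1 u2 v1 v2 p q in W F FE FW WF *.
have k2 : 2 < k by apply: ltnW.
pose d e : nat := e \in F.
pose deg w := \sum_(e in edges C | w \in e) d e.
pose L i := C3_left_edge u1 u2 v1 v2 p q i.
pose Q i := C3_right_edge u1 u2 v1 v2 p q i.
pose e0 := C3_core_edge u1 u2 v1 v2 p q.
have cardF : #|F| = d e0 + \sum_(i < p) d (L i) + \sum_(i < q) d (Q i).
  rewrite -(big_C3_edges _ d) // -sum1_card [in RHS]big_mkcond [in LHS]big_mkcond /=.
  by apply: eq_bigr => e _; rewrite /d; case: (boolP (e \in F)) => [/(subsetP FE) ->|_] //; case: ifP.
have degW w : (0 < deg w) <= (w \in W).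
  rewrite /deg; case: posnP => // deg0.
  have [e /andP[_ we] eF] : exists2 e, (e \in edges C) && (w \in e) & e \in F.
    move: deg0; rewrite lt0n sum_nat_eq0 negb_forall => /existsP[e].
    by rewrite negb_imply eqb0 negbK => /andP[]; exists e.
  by rewrite (subsetP (FW _ eF)).
have handshake : \sum_w deg w = #|F| * k.
  have uC : uniform k C by apply: uniform_C3 => //; lia.
  rewrite /deg (exchange_big_dep (mem (edges C))) /=; last by move=> v e _ /andP[].
  rewrite -sum1_card [in RHS]big_mkcond /= big_distrl /= [in LHS]big_mkcond /=.
  apply: eq_bigr => e _; case: ifP => eE.
    rewrite (eq_bigl [in e]); last by move=> w; rewrite eE.
    by rewrite sum_nat_const uC // mulnC /d; case: (e \in F).
  by case: ifP => // /(subsetP FE); rewrite eE.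
(* [exc w] is the number of pairs of edges of [F] that meet at [w]. *)
pose exc (w : vertices C) : nat := match w with
  | inl (inl v) => (v == u1) * (d e0 * d (L 0)) + (v == u2) * (d e0 * d (L p.-1))
          + (v == v1) * (d e0 * d (Q 0)) + (v == v2) * (d e0 * d (Q q.-1))
  | inl (inr j) => if k - 1 %| j.+1 then
        ((L (j.+1 %/ (k - 1)).-1 \in F) && (L (j.+1 %/ (k - 1)) \in F) : nat) else 0
  | inr j => if k - 1 %| j.+1 then
        ((Q (j.+1 %/ (k - 1)).-1 \in F) && (Q (j.+1 %/ (k - 1)) \in F) : nat) else 0
  end.
have degexc w : deg w <= (w \in W) + exc w.
  apply: (@leq_trans ((0 < deg w) + exc w)); last by rewrite leq_add2r.
  have d1 e : d e <= 1 by rewrite /d; case: (e \in F).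
  case: w => [[v|j]|j]; rewrite /deg /exc.
  - rewrite big_incident_C3_core //= -/(L _) -/(L _) -/(Q _) -/(Q _) -/e0.
    (* By distinctness at most one of the four comparisons with [v] is true, so at most one path
       edge meets the core edge at [v]. *)
    have := count_uniq_mem v huv; rewrite /= ![_ == v]eq_sym.
    have := d1 (L 0); have := d1 (L p.-1); have := d1 (Q 0); have := d1 (Q q.-1); have := d1 e0.
    move: (d e0) (d _) (d _) (d _) (d _) => x y z t w.
    move: (v == u1) (v == u2) (v == v1) (v == v2) (_ \in _); clear.
    by case=> [] [] [] [] [] //=; nia.
  - rewrite big_incident_C3_left //= -/(L _) -/(L _).
    rewrite /d; move: (L _ \in F) (L _ \in F) => x y.
    by case: ifP => _; case: x; case: y.
  - rewrite big_incident_C3_right //= -/(Q _) -/(Q _).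
    rewrite /d; move: (Q _ \in F) (Q _ \in F) => x y.
    by case: ifP => _; case: x; case: y.
have sum_core v0 A : \sum_v (v == v0 :> 'I_k) * A = A.
  by rewrite (bigD1 v0) //= eqxx mul1n big1 ?addn0 // => v /negbTE ->.
have sum_exc : \sum_w exc w =
    d e0 * (d (L 0) + d (L p.-1) + d (Q 0) + d (Q q.-1))
    + \sum_(j < p * (k - 1) - 1) (if k - 1 %| j.+1 then
        ((L (j.+1 %/ (k - 1)).-1 \in F) && (L (j.+1 %/ (k - 1)) \in F) : nat) else 0)
    + \sum_(j < q * (k - 1) - 1) (if k - 1 %| j.+1 then
        ((Q (j.+1 %/ (k - 1)).-1 \in F) && (Q (j.+1 %/ (k - 1)) \in F) : nat) else 0).
  by rewrite !big_sumType /= !big_split /= !sum_core !mulnDr.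
have K0 : 0 < k - 1 by lia.
(* The added term [G 0] is the overlap of the path with the core edge at its start; it turns the
   sums over link vertices into the cyclic sums bounded below. *)
have := sum_at_multiples (fun c => (L c.-1 \in F) && (L c \in F) : nat) K0 p0.
have := sum_at_multiples (fun c => (Q c.-1 \in F) && (Q c \in F) : nat) K0 q0.
have := cyclic_overlaps_bound (fun i => L i \in F) p0.
have := cyclic_overlaps_bound (fun i => Q i \in F) q0.
have : \sum_w deg w <= \sum_w ((w \in W) + exc w) by apply: leq_sum => w _; exact: degexc.
rewrite handshake big_split /= sum_exc -big_mkcond sum1_card -/C.
have kE : #|F| * k = #|F| * (k - 1) + #|F| by rewrite -{1}(subnK (ltnW (ltnW k2))) mulnDr muln1.
have allL0 : [forall i : 'I_p, L i \in F] -> L 0 \in F by move=> /forallP/(_ (Ordinal p0)).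
have allQ0 : [forall i : 'I_q, Q i \in F] -> Q 0 \in F by move=> /forallP/(_ (Ordinal q0)).
rewrite kE !andbb; rewrite /d in cardF *.
set XL := \sum_(j < p * (k - 1) - 1) _; set XQ := \sum_(j < q * (k - 1) - 1) _.
set TL := \sum_(c < p) _; set TQ := \sum_(c < q) _ => degbound boundQ boundL TQE TLE.
have imp_le (b b' : bool) : (b -> b') -> b <= b' by case: b b' => [] [] // /(_ isT).
have [e0F LF QF FW1] := overlap_count_saturated (leq_b1 _) (leq_b1 _) (leq_b1 _)
  (imp_le _ _ allL0) (imp_le _ _ allQ0) cardF WF degbound boundQ boundL TQE TLE.
move: LF QF e0F => /eqP; rewrite eqb1 => /forallP LF /eqP.
rewrite eqb1 => /forallP QF /eqP; rewrite eqb1 => e0F.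
have FE' : F = edges C.
  apply/eqP; rewrite eqEsubset FE; apply/subsetP => e.
  case/setUP=> [/imsetP[e1 /setUP[]]|/imsetP[i _ ->]]; last exact: QF.
    by move=> /imsetP[e2 /set1P -> ->] ->.
  by move=> /imsetP[i _ ->] ->; exact: LF.
have cV : #|vertices C| = k + (p * (k - 1) - 1) + (q * (k - 1) - 1).
  by rewrite !card_join_path_vertices card_ord.
(* [FW1] and [#|F| = p + q + 1] give [#|W| >= (p + q + 1) * (k - 1) - 1], which is the number of
   vertices of [C3]. *)
split => //; apply/eqP; rewrite eqEcard subsetT cardsT [X in X <= _]cV /=.
have cardC : #|F| = (p + q).+1 by rewrite FE' card_C3_edges.
move: FW1; rewrite cardC mulSn mulnDl.
have : 0 < p * (k - 1) by rewrite muln_gt0 p0.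
have : 0 < q * (k - 1) by rewrite muln_gt0 q0.
move: (p * _) (q * _) #|W| => pk qk cW; clear -k2; lia.
Qed.

Lemma is_base_C3 (k : nat) (u1 u2 v1 v2 : 'I_k) (p q : nat) :
  3 < k -> uniq [:: u1; u2; v1; v2] -> 0 < p -> 0 < q ->
  is_base k [set: vertices (C3 u1 u2 v1 v2 p q)] (edges (C3 u1 u2 v1 v2 p q)).
Proof.
move=> k3 huv p0 q0; move: (huv) => /= /and4P[]; rewrite !inE !negb_or => /and3P[uu _ _] _ vv _.
have k2 := ltnW k3; split.
- by split => // e _; exact: subsetT.
- exact: isomorphic_bicyclic (isomorphic_sub_hypergraphT _) (bicyclic_C3 _ _ _ _ _).
- move=> W F sWF bWF _ _; apply: C3_sub_bicyclic_full => //.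
  exact: bicyclic_sub_card.
Qed.

Lemma in_B3_C3 (k m : nat) (u1 u2 v1 v2 : 'I_k) (p q : nat) :
  3 < k -> uniq [:: u1; u2; v1; v2] -> 0 < p -> 0 < q -> m = (p + q).+1 ->
  in_B3 k m (C3 u1 u2 v1 v2 p q).
Proof.
move=> k3 huv p0 q0 mE; move: (huv) => /= /and4P[]; rewrite !inE !negb_or => /and3P[uu _ _] _ vv _.
have k2 := ltnW k3; split.
  by split; [exact: bicyclic_C3|rewrite card_C3_edges].
exists setT, (edges (C3 u1 u2 v1 v2 p q)); split; first exact: is_base_C3.
by exists u1, u2, v1, v2, p, q; split => //; exact: isomorphic_sub_hypergraphT.
Qed.

(** * Variational description of the spectral radius *)

Lemma tuples_completing_edge (V : finType) (r : nat) (v : V) (e : {set V})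
    (t : r.-tuple V) :
  #|e| = r.+1 -> v \in e ->
  ([set w in v :: t] == e) = all [in e :\ v] t && uniq t.
Proof.
move=> ce ve; apply/eqP/andP => [se|[/allP te ut]].
  have ut : uniq (v :: t).
    by apply/card_uniqP; rewrite -cardsE se ce /= size_tuple.
  case/andP: (ut) => vt ut'; split => //; apply/allP => w wt.
  rewrite !inE -se inE in_cons wt orbT andbT.
  by apply: contraNneq vt => <-.
have uvt : uniq (v :: t).
  rewrite /= ut andbT; apply/negP => /te; by rewrite !inE eqxx.
apply/eqP; rewrite eqEcard ce cardsE (card_uniqP uvt) /= size_tuple leqnn andbT.
apply/subsetP => w; rewrite inE in_cons => /orP[/eqP-> //|/te].
by rewrite !inE => /andP[].
Qed.


Local Open Scope ring_scope.
Local Open Scope complex_scope.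

(** Group the tuples by the edge they complete. An edge [e] at [v] arises from the [(k - 1)!]
    orderings of [e :\ v], all with the same product, which cancels the tensor entry. *)
Lemma tensor_mul_adjacency (R : realType) (k : nat) (H : hypergraph)
    (x : {ffun vertices H -> R[i]}) (v : vertices H) :
  (0 < k)%N -> uniform k H ->
  tensor_mul (@adjacency_tensor R k H) x v =
  \sum_(e in edges H | v \in e) \prod_(w in e :\ v) x w.
Proof.
move=> k0 uH; rewrite /tensor_mul /adjacency_tensor.
pose S (t : (k - 1).-tuple (vertices H)) : {set vertices H} := [set w in v :: t].
transitivity (\sum_(e in edges H | v \in e)
   \sum_(t : (k-1).-tuple (vertices H) | S t == e) ((k - 1)`!%:R)^-1 * \prod_(w <- t) x w).
  transitivity (\sum_(t : (k-1).-tuple (vertices H) | (S t \in edges H) && (v \in S t))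
      ((k - 1)`!%:R)^-1 * \prod_(w <- t) x w).
    rewrite [RHS]big_mkcond; apply: eq_bigr => t _.
    have -> : v \in S t by rewrite !inE eqxx.
    by rewrite andbT; case: ifP => // _; rewrite mul0r.
  rewrite (partition_big S (fun e => (e \in edges H) && (v \in e))) //=.
  apply: eq_bigr => e /andP[eH ve]; apply: eq_bigl => t.
  by case: eqP => [->|]; rewrite ?eH ?ve ?andbF.
apply: eq_bigr => e /andP[eH ve].
have ce : #|e| = (k - 1).+1 by rewrite uH // subn1 prednK.
have ce' : #|e :\ v| = (k - 1)%N by move: (cardsD1 v e); rewrite ve ce add1n => -[].
transitivity (\sum_(t : (k-1).-tuple (vertices H) | S t == e) ((k - 1)`!%:R)^-1 *
   \prod_(w in e :\ v) x w).
  apply: eq_bigr => t; rewrite tuples_completing_edge // => /andP[/allP te ut].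
  congr (_ * _); rewrite -(big_enum _ _ (e :\ v)); apply: perm_big.
  have ue := enum_uniq (e :\ v).
  have te' : {subset t <= enum (e :\ v)} by move=> w /te; rewrite mem_enum.
  have st : (size (enum (e :\ v)) <= size t)%N by rewrite -cardE ce' size_tuple.
  have [_ eq_te] := uniq_min_size ut te' st.
  by apply: uniq_perm.
rewrite big_const iter_addr addr0 -[X in _ = X]mul1r -mulrnAl; congr (_ * _).
rewrite (eq_card (B := [set t : (k-1).-tuple (vertices H) | all [in e :\ v] t & uniq t])); last first.
  by move=> t; rewrite [RHS]inE -tuples_completing_edge //; exact: erefl.
rewrite card_uniq_tuples ce' ffactnn -mulr_natr mulVf //.
by rewrite pnatr_eq0 -lt0n fact_gt0.
Qed.

(** Collatz-Wielandt argument: take absolute values in the eigenvalue equation at a vertex [v] where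
    [q v = |y v| / x v] is largest, and replace every [|y w|] by [q v * x w]; the powers of [q v]
    cancel. The condition on [x] is multiplied by [x v] so that it involves products over full
    edges. *)
Lemma spectral_radius_ub (R : realType) (k : nat) (H : hypergraph)
    (x : vertices H -> R) (r : R) (lambda : R[i]) :
  (0 < k)%N -> uniform k H -> (forall v, 0 < x v) ->
  (forall v, \sum_(e in edges H | v \in e) \prod_(w in e) x w <= r * x v ^+ k) ->
  tensor_eigenvalue (@adjacency_tensor R k H) lambda ->
  ComplexField.Normc.normc lambda <= r.
Proof.
move=> k0 uH x0 xr [y y0 ey].
pose nm := @ComplexField.Normc.normc R.
have nmE z : `|z| = (nm z)%:C by [].
have nmge z : 0 <= nm z by rewrite -ler0c -nmE.
have [v0 yv0] : exists v, y v != 0.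
  apply/existsP; apply: contraNT y0; rewrite negb_exists => /forallP y0.
  by apply/eqP/ffunP => v; rewrite ffunE; apply/eqP; move: (y0 v); rewrite negbK.
pose q v := nm (y v) / x v.
case: (@arg_maxP _ R _ v0 predT q erefl) => v _ vmax.
have q0 : 0 < q v.
  apply: lt_le_trans (vmax v0 _) => //; rewrite divr_gt0 // lt_neqAle nmge andbT eq_sym.
  by apply: contraNneq yv0 => /(@ComplexField.Normc.eq0_normc R) ->.
have yq w : nm (y w) <= q v * x w by rewrite -ler_pdivrMr //; exact: vmax.
have yv : nm (y v) = q v * x v by rewrite /q divfK // gt_eqF.
have yv_gt0 : 0 < nm (y v) by rewrite yv mulr_gt0.
rewrite -[X in X <= _]/(nm lambda) -(ler_pM2r (exprn_gt0 (k-1) yv_gt0)).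
have := congr1 (fun z => `|z|) (ey v); rewrite normrM normrX !nmE -rmorphXn -rmorphM => ny.
rewrite -lecR; move: ny => <-; rewrite -nmE tensor_mul_adjacency //.
apply: le_trans (ler_norm_sum _ _ _) _.
apply: (@le_trans _ _ ((\sum_(e in edges H | v \in e) \prod_(w in e :\ v) (q v * x w))%:C)).
  rewrite rmorph_sum; apply: ler_sum => e _; rewrite normr_prod rmorph_prod.
  by apply: ler_prod => w _; rewrite normr_ge0 /= nmE lecR yq.
rewrite lecR.
have -> : \sum_(e in edges H | v \in e) \prod_(w in e :\ v) (q v * x w) =
    q v ^+ (k-1) / x v * \sum_(e in edges H | v \in e) \prod_(w in e) x w.
  rewrite mulr_sumr; apply: eq_bigr => e /andP[eH ve].
  have ce' : #|e :\ v| = (k - 1)%N.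
    by move: (cardsD1 v e); rewrite ve uH // add1n => ->; rewrite subn1.
  rewrite big_split /= prodr_const ce' [in RHS](big_setD1 v) //= -mulrA.
  by rewrite [in RHS]mulKf // gt_eqF.
rewrite yv; clear vmax yq yv; move: (q v) q0 => c c0.
rewrite exprMn (mulrCA r) -mulrA ler_pM2l ?exprn_gt0 //.
rewrite mulrC ler_pdivrMr //; apply: le_trans (xr v) _.
by rewrite -mulrA -exprSr subn1 prednK.
Qed.

(** * Existence of a maximizer of the form, and its eigenvalue equation *)

Lemma nth_root_exists (R : realType) (k : nat) (a : R) :
  (0 < k)%N -> 0 <= a -> exists2 b : R, 0 <= b & b ^+ k = a.
Proof.
move=> k0 a0; exists (a `^ k%:R^-1)%R; first exact: powR_ge0.
by rewrite -powR_mulrn ?powR_ge0 // -powRrM mulVf ?powRr1 // pnatr_eq0 -lt0n.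
Qed.

Lemma nth_root_pos_exists (R : realType) (k : nat) (a : R) :
  (0 < k)%N -> 0 < a -> exists2 b : R, 0 < b & b ^+ k = a.
Proof.
move=> k0 a0; have [b b0 bk] := nth_root_exists k0 (ltW a0).
exists b => //; rewrite lt_neqAle b0 andbT eq_sym; apply: contraTneq a0 => b00.
by rewrite -bk b00 expr0n gtn_eqF // ltxx.
Qed.

(** Passing to the limit [y -> a] from the right takes the place of differentiating the form at its
    maximizer. *)
Lemma le_monomial_right_limit (R : realType) (n : nat) (a c l : R) :
  (forall y, a < y -> c <= l * y ^+ n) -> c <= l * a ^+ n.
Proof.
move=> cy; rewrite leNgt; apply/negP => ac.
have cf : ((l * y ^+ n)%R @[y --> a^'+] --> (l * a ^+ n)%R)%classic.
  apply: cvg_at_right_filter; apply: cvgMl_tmp; exact: exprn_continuous.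
have [y [/= cly /cy]] := filter_ex (filterI (cvgr_lt _ cf _ ac) (nbhs_right_gt a)).
by rewrite leNgt cly.
Qed.

(** The nonnegative part of the unit sphere of the k-norm is closed in a cube that is compact by
    Tychonoff, so the form attains its maximum there; homogeneity of degree [k] extends the bound to
    every nonnegative [y]. *)
Lemma form_maximizer (R : realType) (k : nat) (H : hypergraph) :
  (0 < k)%N -> vertices H -> uniform k H ->
  exists x : vertices H -> R,
    [/\ forall v, 0 <= x v, \sum_v x v ^+ k = 1 &
        forall y : vertices H -> R, (forall v, 0 <= y v) ->
          \sum_(e in edges H) \prod_(w in e) y w <=
          (\sum_(e in edges H) \prod_(w in e) x w) * \sum_v y v ^+ k].
Proof.
move=> k0 v0 uH.
pose T := prod_topology (fun _ : vertices H => R : topologicalType).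
pose f (x : T) : R := \sum_(e in edges H) \prod_(w in e) x w.
pose N (x : T) : R := \sum_v x v ^+ k.
have cp v : continuous (fun x : T => x v : R).
  exact: (@proj_continuous _ (fun _ : vertices H => R : topologicalType) v).
have cf : continuous f.
  apply: continuous_big; first exact: add_continuous.
  by move=> e _; apply: continuous_big; [exact: mul_continuous|move=> w _; exact: cp].
have cN : continuous N.
  apply: continuous_big; first exact: add_continuous.
  move=> v _ x.
  have hc := @cvg_comp _ _ _ (fun x : T => x v : R) (fun a : R => a ^+ k) _ _ _
    (cp v x) (@exprn_continuous R k (x v)).
  exact: hc.
pose K : set T := [set x | (forall v, `[0, 1]%classic (x v)) /\ N x = 1]%classic.
have K0 : (K !=set0)%classic.
  exists (fun v => (v == v0)%:R); split => [v|].
    by rewrite /= in_itv /=; case: (v == v0); rewrite /= ?lexx ?ler01.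
  rewrite /N (bigD1 v0) //= eqxx expr1n big1 ?addr0 // => v /negbTE ->.
  by rewrite expr0n gtn_eqF.
have cK : compact K.
  apply: (@subclosed_compact _ _ [set x : T | forall v, `[0, 1]%classic (x v)]%classic).
  - have -> : K = ([set x : T | forall v, `[0, 1]%classic (x v)] `&` N @^-1` [set y | y = 1])%classic by [].
    apply: closedI; last by apply: preimage_closed; [move=> x _; exact: cN|exact: closed_eq].
    have -> : [set x : T | forall v, `[0, 1]%classic (x v)]%classic =
       (\bigcap_(v in classical_sets.setT) ((fun x : T => x v) @^-1` `[0, 1]))%classic.
      by apply/seteqP; split => [x xK v _|x xK v]; [exact: xK|exact: xK v I].
    by apply: closed_bigI => v _; apply: preimage_closed; [move=> x _; exact: cp|exact: itv_closed].
  - exact: (@tychonoff (vertices H) (fun _ => R : topologicalType)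
      (fun _ => `[0, 1]%classic) (fun _ => @segment_compact R 0 1)).
  - by move=> x [].
have [x /set_mem[x01 Nx] xmax] := compact_EVT_max K0 cK (continuous_subspaceT cf).
exists x; split => [v| //|y y0].
  by have := x01 v; rewrite /= in_itv /= => /andP[].
(* A [y] of norm 0 cannot be rescaled; it vanishes, and so does each edge product, because edges are
   nonempty. *)
have [Ny0|Ny0] := eqVneq (\sum_v y v ^+ k) 0.
  rewrite Ny0 mulr0 big1 // => e eH.
  have [w we] : exists w, w \in e by apply/card_gt0P; rewrite uH.
  rewrite (bigD1 w) //=.
  have := psumr_eq0P (fun v _ => exprn_ge0 k (y0 v)) Ny0 => /(_ w isT)/eqP.
  by rewrite expf_eq0 k0 /= => /eqP ->; rewrite mul0r.
have Nyp : 0 < \sum_v y v ^+ k.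
  by rewrite lt_neqAle eq_sym Ny0 sumr_ge0 // => v _; rewrite exprn_ge0.
have [c c0 ck] := nth_root_pos_exists k0 Nyp.
pose z : T := fun v => y v / c.
have zK : K z.
  have Nz : N z = 1.
    rewrite /N; under eq_bigr do rewrite exprMn exprVn.
    by rewrite -mulr_suml ck mulfV.
  split => // v; rewrite /= in_itv /= divr_ge0 ?(ltW c0) //=.
  have : z v ^+ k <= 1.
    rewrite -Nz /N (bigD1 v) //= lerDl sumr_ge0 // => w _.
    by rewrite exprn_ge0 // divr_ge0 // ltW.
  by rewrite expr_le1 // divr_ge0 // ltW.
have := xmax z (mem_set zK); rewrite -ck -ler_pdivrMr ?exprn_gt0 //; apply: le_trans.
rewrite /f mulr_suml; apply: ler_sum => e eH.
by rewrite big_split /= prodr_const uH // exprVn.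
Qed.

Lemma sum_incidences (A : nmodType) (k : nat) (H : hypergraph)
    (F : {set vertices H} -> A) :
  uniform k H ->
  \sum_v \sum_(e in edges H | v \in e) F e = (\sum_(e in edges H) F e) *+ k.
Proof.
move=> uH; rewrite (exchange_big_dep (mem (edges H))) /=; last by move=> v e _ /andP[].
rewrite -sumrMnl; apply: eq_bigr => e eH.
by under eq_bigl do rewrite eH /=; rewrite sumr_const uH.
Qed.

(* Moving one coordinate upwards yields [d v <= k M x_v^(k-1)]; as
   [sum_v x_v d v = k M] (Euler), none of these inequalities is strict where
   [x_v > 0], and where [x_v = 0] the bound itself is [0]. *)
Lemma maximizer_eigenvector (R : realType) (k : nat) (H : hypergraph)
    (x : vertices H -> R) (M : R) :
  (1 < k)%N -> uniform k H -> (forall v, 0 <= x v) -> \sum_v x v ^+ k = 1 ->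
  M = \sum_(e in edges H) \prod_(w in e) x w ->
  (forall y : vertices H -> R, (forall v, 0 <= y v) ->
     \sum_(e in edges H) \prod_(w in e) y w <= M * \sum_v y v ^+ k) ->
  forall v, \sum_(e in edges H | v \in e) \prod_(w in e :\ v) x w =
            M *+ k * x v ^+ (k - 1).
Proof.
move=> k1 uH x0 Nx Mx xmax.
have M0 : 0 <= M by rewrite Mx; apply: sumr_ge0 => e _; exact: prodr_ge0.
pose d v := \sum_(e in edges H | v \in e) \prod_(w in e :\ v) x w.
have d0 v : 0 <= d v by apply: sumr_ge0 => e _; exact: prodr_ge0.
have dle v : d v <= M *+ k * x v ^+ (k - 1).
  apply: le_monomial_right_limit => y xy.
  pose z w := if w == v then y else x w.
  have y0 : 0 <= y by apply: le_trans (x0 v) (ltW xy).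
  have z0 w : 0 <= z w by rewrite /z; case: eqP.
  have fz : \sum_(e in edges H) \prod_(w in e) z w = M + (y - x v) * d v.
    rewrite Mx /d mulr_sumr.
    rewrite [in RHS]big_mkcondr -big_split /=; apply: eq_bigr => e eH.
    case: ifP => ve; last first.
      rewrite addr0; apply: eq_bigr => w we; rewrite /z; case: eqP we => // ->.
      by rewrite ve.
    rewrite (big_setD1 v) //= [in RHS](big_setD1 v) //= /z eqxx -mulrDl addrC subrK.
    by congr (_ * _); apply: eq_bigr => w; rewrite !inE => /andP[/negbTE -> _].
  have Nz : \sum_w z w ^+ k = 1 + (y ^+ k - x v ^+ k).
    rewrite -Nx (bigD1 v) //= [in RHS](bigD1 v) //= {1}/z eqxx [RHS]addrC addrA subrK.
    by congr (_ + _); apply: eq_bigr => w wv; rewrite /z (negbTE wv).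
  (* After [M] is removed from both sides, [y - x v] factors out of both; what remains of
     [y ^+ k - x v ^+ k] is a sum of [k] terms, each at most [y ^+ (k - 1)]. *)
  have := xmax z z0; rewrite fz Nz mulrDr mulr1 lerD2l subrXX mulrCA.
  rewrite ler_pM2l ?subr_gt0 // => /le_trans; apply.
  rewrite mulrnAl -mulrnAr ler_wpM2l //.
  have -> : y ^+ (k - 1) *+ k = \sum_(i < k) y ^+ (k - 1) by rewrite sumr_const card_ord.
  apply: ler_sum => i _.
  rewrite subn1 -{2}(subnK (_ : i <= k.-1)%N); last by rewrite -ltnS prednK // ltnW.
  rewrite exprD ler_wpM2l ?exprn_ge0 //.
  by rewrite lerXn2r // ?nnegrE // ltW.
have euler : \sum_v x v * d v = M *+ k.
  rewrite Mx -(sum_incidences _ uH); apply: eq_bigr => v _.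
  rewrite mulr_sumr; apply: eq_bigr => e /andP[_ ve].
  by rewrite [RHS](big_setD1 v).
have gap0 v : x v * (M *+ k * x v ^+ (k - 1) - d v) = 0.
  apply: (psumr_eq0P (P := xpredT) (F := fun v => x v * (M *+ k * x v ^+ (k - 1) - d v))) => //.
    by move=> w _; rewrite mulr_ge0 // subr_ge0.
  under eq_bigr do rewrite mulrBr mulrCA -exprS subn1 prednK ?(ltnW k1) //.
  by rewrite sumrB euler -mulr_sumr Nx mulr1 subrr.
move=> v; apply/eqP; rewrite -/(d v) eq_sym -subr_eq0.
have /eqP := gap0 v; rewrite mulf_eq0 => /orP[/eqP xv0|//].
rewrite xv0 expr0n subn_eq0 leqNgt k1 mulr0 sub0r oppr_eq0 eq_le d0 andbT.
by have := dle v; rewrite xv0 expr0n subn_eq0 leqNgt k1 mulr0.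
Qed.

Lemma spectral_radius_le (R : realType) (k : nat) (H : hypergraph)
    (x : vertices H -> R) (r : R) :
  (0 < k)%N -> uniform k H -> 0 <= r -> (forall v, 0 < x v) ->
  (forall v, \sum_(e in edges H | v \in e) \prod_(w in e) x w <= r * x v ^+ k) ->
  spectral_radius R k H <= r.
Proof.
move=> k0 uH r0 x0 xr; rewrite /spectral_radius.
(* When [E] has no supremum, [sup E] is [0] by convention, and [0 <= r] settles that case. *)
set E := (X in sup X); have [hE|/sup_out -> //] := boolp.pselect (has_sup E).
apply: ge_sup; first by case: hE.
move=> _ [lambda ev] /= [<-]; exact: spectral_radius_ub x0 xr ev.
Qed.

(** The maximum [M] of the form makes [k M] an eigenvalue, and [k M] bounds the quotient of every
    test vector [y] from above. *)
Lemma spectral_radius_ge (R : realType) (k : nat) (H : hypergraph)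
    (y : vertices H -> R) (r : R) :
  (1 < k)%N -> uniform k H -> (forall v, 0 <= y v) -> 0 < \sum_v y v ^+ k ->
  r * \sum_v y v ^+ k <= (\sum_(e in edges H) \prod_(w in e) y w) *+ k ->
  r <= spectral_radius R k H.
Proof.
move=> k1 uH y0 Ny ry; have k0 := ltnW k1.
have [v0 _|v0] := pickP (fun _ : vertices H => true); last first.
  by move: Ny; rewrite big1 ?ltxx // => v; have := v0 v.
have [x [x0 Nx xmax]] := form_maximizer R k0 v0 uH.
pose M := \sum_(e in edges H) \prod_(w in e) x w; rewrite -/M in xmax.
have xE := maximizer_eigenvector k1 uH x0 Nx erefl xmax.
have M0 : 0 <= M by apply: sumr_ge0 => e _; exact: prodr_ge0.
apply: (@le_trans _ _ (M *+ k)).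
  by rewrite -(ler_pM2r Ny) (le_trans ry) // mulrnAl lerMn2r xmax // orbT.
have ev : tensor_eigenvalue (@adjacency_tensor R k H) (M *+ k)%:C.
  exists [ffun v => (x v)%:C].
    apply/eqP => /ffunP xz; move: Nx; rewrite big1 => [/eqP|v _].
      by rewrite eq_sym oner_eq0.
    by have := xz v; rewrite !ffunE => -[->]; rewrite expr0n gtn_eqF.
  move=> v; rewrite tensor_mul_adjacency // ffunE -rmorphXn -rmorphM -xE rmorph_sum.
  apply: eq_bigr => e _; rewrite rmorph_prod; by apply: eq_bigr => w _; rewrite ffunE.
have Mk : exists2 lambda : R[i],
    tensor_eigenvalue (@adjacency_tensor R k H) lambda & `|lambda| = (M *+ k)%:C.
  by exists (M *+ k)%:C; rewrite // ger0_norm // ler0c mulrn_wge0.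
apply: sup_upper_bound; last exact: Mk.
split; first by exists (M *+ k).
(* Using the supremum requires bounded eigenvalues: the constant vector 1 bounds them by the maximum
   degree, hence by the number of edges. *)
exists (#|edges H|%:R) => _ [lambda evl] /= [<-].
apply: (spectral_radius_ub k0 uH (x := fun _ => 1) _ _ evl) => // v.
under eq_bigr do rewrite big1 //.
rewrite sumr_const expr1n mulr1 ler_nat; apply: subset_leq_card.
by apply/subsetP => e; rewrite unfold_in => /andP[].
Qed.

Local Close Scope complex_scope.

(** * The explicit weight vector *)

Ltac positivity := by repeat first [done | apply: mulr_gt0 | apply: addr_gt0].

(** A discrete hyperbolic cosine centred at [n / 2], normalized to be 1 at both ends. *)
Definition path_profile (R : realType) (t : R) (n i : nat) : R :=
  (t ^+ i + t ^+ (n - i)) / (1 + t ^+ n).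

(** For [n > 0] this is [t + t^-1 - path_profile t n 1]. *)
Definition path_ratio (R : realType) (t : R) (n : nat) : R :=
  (t ^+ n.+2 + 1) / (t * (t ^+ n + 1)).

Lemma path_profile_gt0 (R : realType) (t : R) (n i : nat) :
  0 < t -> 0 < path_profile t n i.
Proof. by move=> t0; rewrite divr_gt0 ?addr_gt0 ?exprn_gt0. Qed.

Lemma path_ratio_gt0 (R : realType) (t : R) (n : nat) : 0 < t -> 0 < path_ratio t n.
Proof. by move=> t0; rewrite divr_gt0 ?mulr_gt0 ?addr_gt0 ?exprn_gt0. Qed.

Lemma path_profile_sym (R : realType) (t : R) (n i : nat) :
  (i <= n)%N -> path_profile t n (n - i) = path_profile t n i.
Proof. by move=> ni; rewrite /path_profile subKn // addrC. Qed.

Lemma path_profile0 (R : realType) (t : R) (n : nat) :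
  0 < t -> path_profile t n 0 = 1.
Proof. by move=> t0; rewrite /path_profile subn0 expr0 divff // gt_eqF // addr_gt0 ?exprn_gt0. Qed.

Lemma path_profile1 (R : realType) (t : R) (n : nat) :
  0 < t -> (0 < n)%N -> path_profile t n 1 = t + t^-1 - path_ratio t n.
Proof.
move=> t0; case: n => // n _; rewrite /path_profile /path_ratio subn1 /= !exprS expr0.
have := exprn_gt0 n t0; move: (t ^+ n) => A A0.
by field; rewrite !gt_eqF // ?addr_gt0 // mulr_gt0.
Qed.

Lemma path_profile_rec (R : realType) (t : R) (n i : nat) :
  0 < t -> (0 < i < n)%N ->
  path_profile t n i.-1 + path_profile t n i.+1 = (t + t^-1) * path_profile t n i.
Proof.
move=> t0 /andP[]; case: i => // i _ ni; rewrite /path_profile /=.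
have -> : (n - i = (n - i.+2).+2)%N by lia.
have -> : (n - i.+1 = (n - i.+2).+1)%N by lia.
have D0 : 1 + t ^+ n != 0 by rewrite gt_eqF // addr_gt0 ?exprn_gt0.
move: (1 + t ^+ n) D0 => D D0.
rewrite !exprS; move: (t ^+ i) (t ^+ (n - i.+2)) => A B.
by field; rewrite D0 gt_eqF.
Qed.

Lemma path_ratio_mono (R : realType) (t : R) (m n : nat) :
  1 < t -> (m <= n)%N -> path_ratio t m <= path_ratio t n.
Proof.
move=> t1; have t0 : 0 < t by lra.
elim: n => [|n IH]; first by rewrite leqn0 => /eqP ->.
rewrite leq_eqVlt => /orP[/eqP -> //|/IH/le_trans]; apply.
rewrite /path_ratio !exprS; have := exprn_gt0 n t0; move: (t ^+ n) => A A0.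
rewrite ler_pdivrMr; last positivity.
rewrite mulrAC ler_pdivlMr; last positivity.
rewrite -subr_ge0.
have -> : (t * (t * (t * A)) + 1) * (t * (A + 1)) - (t * (t * A) + 1) * (t * (t * A + 1)) =
   t * A * (t - 1) ^+ 2 * (t + 1) by ring.
by rewrite !mulr_ge0 ?exprn_even_ge0 //; lra.
Qed.

(** No integer lies strictly between [p] and [q], so [t ^+ a - t ^+ p] and [t ^+ a - t ^+ q] never
    have opposite signs. As [a + b = p + q], their product is [t ^+ a] times the difference in
    question. *)
Lemma balanced_powers_min (R : realType) (t : R) (a b p q : nat) :
  1 < t -> (a + b = p + q)%N -> (p <= q.+1)%N -> (q <= p.+1)%N ->
  t ^+ p + t ^+ q <= t ^+ a + t ^+ b.
Proof.
move=> t1 abpq pq qp; have t0 : 0 < t by lra.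
have : 0 <= (t ^+ a - t ^+ p) * (t ^+ a - t ^+ q).
  have [ap|pa] := leqP a p.
    have [aq|qa] := leqP a q.
      by apply: mulr_le0; rewrite subr_le0 ler_eXn2l.
    have -> : a = p by lia.
    by rewrite subrr mul0r.
  have [aq|qa] := leqP q a; first by apply: mulr_ge0; rewrite subr_ge0 ler_eXn2l // ltnW.
  have -> : a = q by lia.
  by rewrite subrr mulr0.
have -> : (t ^+ a - t ^+ p) * (t ^+ a - t ^+ q) =
    t ^+ a * (t ^+ a + t ^+ b - (t ^+ p + t ^+ q)).
  rewrite mulrBl !mulrBr !mulrDr -!exprD abpq [(a + p)%N]addnC; ring.
by rewrite pmulr_rge0 ?exprn_gt0 // subr_ge0.
Qed.

Lemma path_ratio_balanced (R : realType) (t : R) (a b p q : nat) :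
  1 < t -> (a + b <= p + q)%N -> (p <= q.+1)%N -> (q <= p.+1)%N ->
  path_ratio t a * path_ratio t b <= path_ratio t p * path_ratio t q.
Proof.
move=> t1 abpq pq qp; have t0 : 0 < t by lra.
(* Monotonicity allows [a] to be raised to [p + q - b], which reduces the claim to equal sums. *)
apply: (@le_trans _ _ (path_ratio t (p + q - b) * path_ratio t b)).
  by rewrite ler_wpM2r ?path_ratio_mono ?ltW ?path_ratio_gt0 //; lia.
have cb : (p + q - b + b = p + q)%N by lia.
move: (p + q - b)%N cb => c cb.
have S := balanced_powers_min t1 cb pq qp.
have P : t ^+ c * t ^+ b = t ^+ p * t ^+ q by rewrite -!exprD cb.
have P1 : 1 <= t ^+ p * t ^+ q by rewrite -exprD exprn_ege1 // ltW.
rewrite /path_ratio !exprS.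
have := exprn_gt0 c t0; have := exprn_gt0 b t0.
have := exprn_gt0 p t0; have := exprn_gt0 q t0.
move: S P P1; move: (t ^+ c) (t ^+ b) (t ^+ p) (t ^+ q) => U V X Y S P P1 Y0 X0 V0 U0.
rewrite !mulf_div ler_pdivrMr; last positivity.
rewrite mulrAC ler_pdivlMr; last positivity.
rewrite -subr_ge0.
(* The identity holds for independent [U], [V], [X], [Y]; its second summand vanishes because
   [U * V = X * Y]. *)
have -> : (t * (t * X) + 1) * (t * (t * Y) + 1) * (t * (U + 1) * (t * (V + 1))) -
    (t * (t * U) + 1) * (t * (t * V) + 1) * (t * (X + 1) * (t * (Y + 1))) =
    t ^+ 2 * ((U + V - (X + Y)) * ((t ^+ 2 - 1) * (t ^+ 2 * (X * Y) - 1))) +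
    t ^+ 2 * (U * V - X * Y) * (t ^+ 2 * (X + Y) + 1 - t ^+ 4 * (X + Y + 1)).
  by ring.
rewrite P subrr mulr0 mul0r addr0.
have t2 : 1 <= t ^+ 2 by rewrite exprn_ege1 // ltW.
apply: mulr_ge0; first by rewrite exprn_ge0 // ltW.
apply: mulr_ge0; first by rewrite subr_ge0.
apply: mulr_ge0; first by rewrite subr_ge0.
by rewrite subr_ge0 mulr_ege1.
Qed.

Lemma path_ratio_root (R : realType) (p q : nat) :
  (0 < p)%N -> (0 < q)%N ->
  exists2 t : R, 1 < t & path_ratio t p * path_ratio t q = t + t^-1.
Proof.
move=> p0 q0.
(* [f] is the equation with denominators cleared. Its value at 1 is [4 - 8], so the root is strictly
   above 1. *)
pose f : {poly R} := ('X^(p.+2) + 1) * ('X^(q.+2) + 1) -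
   'X * ('X^2 + 1) * ('X^p + 1) * ('X^q + 1).
have fE x : f.[x] = (x ^+ p.+2 + 1) * (x ^+ q.+2 + 1) -
    x * (x ^+ 2 + 1) * (x ^+ p + 1) * (x ^+ q + 1) by rewrite /f !hornerE.
have f1 : f.[1] < 0 by rewrite fE !expr1n; lra.
(* At 4 the leading terms are [256 * X * Y] against [68 * X * Y], with [X] and [Y] at least 4. *)
have f4 : 0 <= f.[4].
  rewrite fE !exprS !expr0.
  have P4 n : (0 < n)%N -> 4 <= (4 : R) ^+ n.
    by case: n => // n _; rewrite exprS ler_peMr // exprn_ege1 // ler1n.
  have := P4 p p0; have := P4 q q0; move: (_ ^+ p) (_ ^+ q) => X Y Y4 X4; nra.
have /(poly_ivt (ler1n _ 4)) : f.[1] <= 0 <= f.[4] by rewrite ltW.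
case=> t /andP[t1 _] /rootP ft; have tgt1 : 1 < t.
  by rewrite lt_neqAle t1 andbT; apply: contraTneq f1 => ->; rewrite ft ltxx.
have t0 : 0 < t by lra.
exists t => //; move/eqP: ft; rewrite fE subr_eq0 => /eqP ft.
rewrite /path_ratio mulf_div ft.
have := exprn_gt0 p t0; have := exprn_gt0 q t0; move: (t ^+ p) (t ^+ q) => X Y Y0 X0.
by field; rewrite !gt_eqF ?addr_gt0.
Qed.

(** * Weights along a loose path and on the core edge *)

(* The [k]-th power of the eigenvector at position [l] of a loose path whose
   link vertices carry [h 0 ^ 2, h 1 ^ 2, ...]. *)
Definition path_weight (R : realType) (k : nat) (s : R) (h : nat -> R) (l : nat) : R :=
  if (k - 1 %| l)%N then h (l %/ (k - 1))%N ^+ 2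
  else h (l %/ (k - 1))%N * h (l %/ (k - 1)).+1%N / s.

Lemma path_vertexP (k : nat) (V : finType) (a b : V) (n l : nat)
    (P : nat -> V + 'I_(n * (k - 1) - 1) -> Prop) :
  (1 < k)%N -> (0 < n)%N -> P 0%N (inl a) -> P (n * (k - 1))%N (inl b) ->
  (forall j : 'I_(n * (k - 1) - 1), P j.+1 (inr j)) ->
  (l <= n * (k - 1))%N -> P l (path_vertex k a b n l).
Proof.
move=> k1 n0 Pa Pb Pj; case: l => // l.
rewrite leq_eqVlt => /orP[/eqP ->|ln]; first by rewrite path_vertex_last.
have lN : (l < n * (k - 1) - 1)%N by lia.
by rewrite -[l]/(nat_of_ord (Ordinal lN)) path_vertex_new.
Qed.

(** Compare [k]-th powers: two link weights and [k - 2] equal interior weights multiply to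
    [(h i * h i.+1) ^+ k / s ^+ (k - 2)], and [s ^+ 2 = r ^+ k]. *)
Lemma prod_path_edge (R : realType) (k : nat) (V : finType) (a b : V) (n i : nat)
    (x : V + 'I_(n * (k - 1) - 1) -> R) (h : nat -> R) (r s : R) :
  (2 < k)%N -> (i < n)%N -> a != b -> 0 < r -> 0 < s -> r ^+ k = s ^+ 2 ->
  (forall j, 0 < h j) -> (forall v, 0 < x v) ->
  x (inl a) ^+ k = h 0%N ^+ 2 -> x (inl b) ^+ k = h n ^+ 2 ->
  (forall j : 'I_(n * (k - 1) - 1), x (inr j) ^+ k = path_weight k s h j.+1) ->
  \prod_(w in path_edge k a b n i) x w = r * (h i * h i.+1) / s.
Proof.
move=> k2 ni ab r0 s0 rk h0 x0 xa xb xj; have k1 := ltnW k2.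
have K0 : (0 < k - 1)%N by rewrite subn_gt0.
have xpos l : (l <= n * (k - 1))%N -> x (path_vertex k a b n l) ^+ k = path_weight k s h l.
  apply: (path_vertexP (P := fun l v => x v ^+ k = path_weight k s h l)) => //.
  - by lia.
  - by rewrite xa /path_weight dvdn0 div0n.
  - by rewrite xb /path_weight dvdn_mull // mulnK.
apply: (pexpIrn (n := k)); rewrite ?nnegrE ?prodr_ge0 //; first by lia.
- by move=> v _; exact: ltW.
- by rewrite ltW // divr_gt0 // !mulr_gt0.
rewrite -prodrXl big_path_edge //.
under eq_bigr do rewrite xpos ?path_position_le //.
have pw0 : path_weight k s h (i * (k - 1) + 0) = h i ^+ 2.
  by rewrite addn0 /path_weight dvdn_mull // mulnK.
have pwl : path_weight k s h (i * (k - 1) + (k - 1)) = h i.+1 ^+ 2.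
  by rewrite addnC -mulSn /path_weight dvdn_mull // mulnK.
have pwm j : (0 < j < k - 1)%N -> path_weight k s h (i * (k - 1) + j) = h i * h i.+1 / s.
  case/andP=> j0 jk; rewrite /path_weight dvdn_addr ?dvdn_mull // gtnNdvd //.
  by rewrite divnMDl // divn_small // addn0.
case: k {k1 K0 xa xb xj xpos x x0} k2 rk pw0 pwl pwm => [|[|k]] // k2 rk pw0 pwl pwm.
rewrite subn1 /= in pw0 pwl pwm *; rewrite big_ord_recl big_ord_recr pw0.
rewrite [X in _ * (_ * X) = _]pwl (eq_bigr (fun _ => h i * h i.+1 / s)); last first.
  by move=> j _; apply: pwm; rewrite /= ltnS ltn_ord.
rewrite prodr_const card_ord !exprMn !exprVn rk.
rewrite !exprSr !expr0; have := h0 i; have := h0 i.+1; move: (h i) (h i.+1) => A B B0 A0.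
have := exprn_gt0 k s0; move: (A ^+ k) (B ^+ k) (s ^+ k) => C D E E0.
by field; rewrite !gt_eqF.
Qed.

(** This is the eigenvalue equation, multiplied by the entry, at a new vertex. At a link it follows
    from the recurrence [h i.-1 + h i.+1 = s * h i]; in the interior of an edge it is the choice of
    the weight. *)
Lemma path_weight_link (R : realType) (k n : nat) (t r z : R) (h W : nat -> R)
    (s := t + t^-1) (j : 'I_(n * (k - 1) - 1)) (i := (j.+1 %/ (k - 1))%N) :
  (1 < k)%N -> 0 < t -> (forall i, h i = z * path_profile t n i) ->
  (forall i, (i < n)%N -> W i = r * (h i * h i.+1) / s) ->
  (if (k - 1 %| j.+1)%N then W i.-1 + W i else W i) = r * path_weight k s h j.+1.
Proof.
move=> k1 t0 hE WE; have jn := ltn_ord j; rewrite /path_weight -/i.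
have K0 : (0 < k - 1)%N by lia.
have iN : (i < n)%N by rewrite /i ltn_divLR //; lia.
case: ifP => [jK|_]; last by rewrite WE // -mulrA.
have i0 : (0 < i)%N by rewrite divn_gt0 // dvdn_leq.
have rec : h i.-1 + h i.+1 = s * h i.
  by rewrite !hE -mulrDr path_profile_rec; [exact: mulrCA | | rewrite i0].
have s0 : s != 0 by rewrite gt_eqF // addr_gt0 ?invr_gt0.
rewrite !WE //; last by lia.
rewrite prednK // -mulrDl -mulrDr [h i.-1 * _]mulrC -mulrDr rec.
by field.
Qed.

(** For distinct arguments the values are [s] at [u1], [u2], [c ^+ 2] at [v1], [v2] and [c]
    elsewhere; the product form makes the product over the core edge factor at once. *)
Definition C3_core_weight (R : realType) (k : nat) (u1 u2 v1 v2 : 'I_k) (s c : R)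
    (v : 'I_k) : R :=
  c * ((if v == u1 then s / c else 1) * (if v == u2 then s / c else 1) *
       ((if v == v1 then c else 1) * (if v == v2 then c else 1))).

Lemma C3_core_weight_gt0 (R : realType) (k : nat) (u1 u2 v1 v2 : 'I_k) (s c : R)
    (v : 'I_k) : 0 < s -> 0 < c -> 0 < C3_core_weight u1 u2 v1 v2 s c v.
Proof.
move=> s0 c0; have sc0 : 0 < s / c by rewrite divr_gt0.
have pos (b : bool) (y : R) : 0 < y -> 0 < (if b then y else 1) by case: b.
by rewrite /C3_core_weight !mulr_gt0 // pos.
Qed.

Lemma prod_C3_core_weight (R : realType) (k : nat) (u1 u2 v1 v2 : 'I_k) (s c : R) :
  0 < c -> \prod_v C3_core_weight u1 u2 v1 v2 s c v = s ^+ 2 * c ^+ k.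
Proof.
move=> c0; rewrite !big_split /= prodr_const card_ord.
have one (w : 'I_k) (y : R) : \prod_v (if v == w then y else 1) = y.
  by rewrite -big_mkcond big_pred1_eq.
by rewrite !one; move: (c ^+ k) => C; field; rewrite gt_eqF.
Qed.

(** With [c] the ratio of the first path, the equations hold exactly everywhere but at [v1] and
    [v2], where the excess has the sign of [s - c * path_ratio t q]. One vector thus serves the
    upper and the lower bound. *)
Lemma C3_weight_vector (R : realType) (k : nat) (u1 u2 v1 v2 : 'I_k) (p q : nat)
    (t r : R) (s := t + t^-1) (c := path_ratio t p) :
  (3 < k)%N -> uniq [:: u1; u2; v1; v2] -> (0 < p)%N -> (0 < q)%N ->
  1 < t -> 0 < r -> r ^+ k = s ^+ 2 ->
  exists2 x : vertices (C3 u1 u2 v1 v2 p q) -> R, forall w, 0 < x w &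
    forall w, \sum_(e in edges (C3 u1 u2 v1 v2 p q) | w \in e) \prod_(z in e) x z =
      r * x w ^+ k +
      (if (w == inl (inl v1)) || (w == inl (inl v2))
       then r * c * (s - c * path_ratio t q) / s else 0).
Proof.
move=> k3 huv p0 q0 t1 r0 rk; set C := C3 u1 u2 v1 v2 p q.
move: (huv); rewrite /= !inE !negb_or => /and4P[/and3P[uu uv1 uv2] /andP[uv3 uv4] vv _].
have k2 := ltnW k3; have k1 := ltnW k2; have k0 := ltnW k1.
have t0 : 0 < t by lra.
have s0 : 0 < s by rewrite addr_gt0 ?invr_gt0.
have c0 : 0 < c by exact: path_ratio_gt0.
(* The scales [w] of [h] and [c] of [f] are chosen so that the path ends carry the core weights, [s]
   at [u1], [u2] and [c ^+ 2] at [v1], [v2]. *)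
pose w := Num.sqrt s; have w0 : 0 < w by rewrite sqrtr_gt0.
have w2 : w ^+ 2 = s by rewrite sqr_sqrtr // ltW.
pose h i := w * path_profile t p i; pose f i := c * path_profile t q i.
have h0 i : 0 < h i by rewrite mulr_gt0 ?path_profile_gt0.
have f0 i : 0 < f i by rewrite mulr_gt0 ?path_profile_gt0.
pose g (v : vertices C) : R := match v with
  | inl (inl v) => C3_core_weight u1 u2 v1 v2 s c v
  | inl (inr j) => path_weight k s h j.+1
  | inr j => path_weight k s f j.+1 end.
have g0 v : 0 < g v.
  have pw0 (y : nat -> R) l : (forall i, 0 < y i) -> 0 < path_weight k s y l.
    move=> y0; rewrite /path_weight; case: ifP => _; first exact: exprn_gt0.
    by rewrite divr_gt0 // mulr_gt0.
  by case: v => [[v|j]|j]; [exact: C3_core_weight_gt0|exact: pw0|exact: pw0].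
have [x xP] : exists x : vertices C -> R, forall v, 0 < x v /\ x v ^+ k = g v.
  apply: (@fin_all_exists (vertices C) (fun=> R) (fun v y => 0 < y /\ y ^+ k = g v)) => v.
  by have [y y0 yk] := nth_root_pos_exists k0 (g0 v); exists y.
have x0 v : 0 < x v by have [] := xP v.
have xk v : x v ^+ k = g v by have [] := xP v.
have P0 n : path_profile t n 0 = 1 by apply: path_profile0.
have Pn n : path_profile t n n = 1 by have := path_profile_sym t (leq0n n); rewrite subn0 P0.
have gu1 : g (inl (inl u1)) = w ^+ 2.
  by rewrite /= /C3_core_weight eqxx (negbTE uu) (negbTE uv1) (negbTE uv2) w2; field; rewrite gt_eqF.
have gu2 : g (inl (inl u2)) = w ^+ 2.
  by rewrite /= /C3_core_weight eqxx eq_sym (negbTE uu) (negbTE uv3) (negbTE uv4) w2; field; rewrite gt_eqF.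
have gv1 : g (inl (inl v1)) = c ^+ 2.
  rewrite /= /C3_core_weight eqxx ![v1 == _]eq_sym (negbTE uv1) (negbTE uv3) eq_sym (negbTE vv); ring.
have gv2 : g (inl (inl v2)) = c ^+ 2.
  rewrite /= /C3_core_weight eqxx ![v2 == _]eq_sym (negbTE uv2) (negbTE uv4) (negbTE vv); ring.
pose L i := C3_left_edge u1 u2 v1 v2 p q i; pose Q i := C3_right_edge u1 u2 v1 v2 p q i.
pose e0 := C3_core_edge u1 u2 v1 v2 p q.
pose W (e : {set vertices C}) := \prod_(z in e) x z.
have WL i : (i < p)%N -> W (L i) = r * (h i * h i.+1) / s.
  move=> ip; rewrite /W big_imset /=; last by move=> z z' _ _; exact: inl_inj.
  apply: (prod_path_edge (x := fun z => x (inl z))) => //; rewrite ?xk ?gu1 ?gu2.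
  - by rewrite /h P0 mulr1.
  - by rewrite /h Pn mulr1.
have WQ i : (i < q)%N -> W (Q i) = r * (f i * f i.+1) / s.
  move=> iq; apply: prod_path_edge => //; rewrite ?xk ?gv1 ?gv2.
  - by rewrite /f P0 mulr1.
  - by rewrite /f Pn mulr1.
have We0 : W e0 = r * c.
  apply: (pexpIrn (n := k)); rewrite ?nnegrE ?prodr_ge0 //.
  - by move=> z _; exact: ltW.
  - by rewrite ltW // mulr_gt0.
  rewrite -prodrXl big_imset /=; last by move=> z z' _ _; exact: inl_inj.
  rewrite big_imset /=; last by move=> z z' _ _; exact: inl_inj.
  under eq_bigr do rewrite xk /=.
  rewrite (eq_bigl xpredT); last by move=> z; rewrite inE.
  by rewrite prod_C3_core_weight // (exprMn k r c) rk.
have h1 : h 0%N * h 1%N / s = s - c.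
  rewrite /h P0 mulr1 mulrA -expr2 w2 mulrAC mulfV ?gt_eqF // mul1r.
  exact: path_profile1.
have hp : h p.-1 * h p.-1.+1 / s = s - c.
  rewrite -h1 mulrC [in RHS]mulrC; congr (_ * _); rewrite prednK // mulrC /h Pn P0.
  by rewrite -subn1 path_profile_sym.
have f1 : f 0%N * f 1%N / s = c ^+ 2 * (s - path_ratio t q) / s.
  by rewrite /f P0 mulr1 mulrA -expr2 path_profile1.
have fq : f q.-1 * f q.-1.+1 / s = c ^+ 2 * (s - path_ratio t q) / s.
  rewrite -f1; congr (_ / _); rewrite prednK // mulrC /f Pn P0.
  by rewrite -subn1 path_profile_sym.
exists x => // v; case: v => [[v|j]|j].
- apply: (etrans (@big_incident_C3_core R 0 +%R k u1 u2 v1 v2 p q W v k2 p0 q0 uu vv)).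
  rewrite -/e0 -/(L 0%N) -/(L p.-1) -/(Q 0%N) -/(Q q.-1).
  have -> : W (L 0%N) = r * (s - c) by rewrite WL // -mulrA h1.
  have -> : W (L p.-1) = r * (s - c) by rewrite WL ?ltn_predL // -mulrA hp.
  have -> : W (Q 0%N) = r * (c ^+ 2 * (s - path_ratio t q) / s) by rewrite WQ // -mulrA f1.
  have -> : W (Q q.-1) = r * (c ^+ 2 * (s - path_ratio t q) / s).
    by rewrite WQ ?ltn_predL // -mulrA fq.
  rewrite We0 xk /= /C3_core_weight.
  rewrite -[inl (inl v) == inl (inl v1)]/(v == v1) -[inl (inl v) == inl (inl v2)]/(v == v2).
  have cN0 : c != 0 by rewrite gt_eqF.
  have sN0 : s != 0 by rewrite gt_eqF.
  move: (path_ratio t q) => c' {f1 fq WQ}.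
  have [->|vu1] := eqVneq v u1.
    by rewrite (negbTE uu) (negbTE uv1) (negbTE uv2) /=; field.
  have [->|vu2] := eqVneq v u2; first by rewrite (negbTE uv3) (negbTE uv4) /=; field.
  have [->|vv1] := eqVneq v v1; first by rewrite (negbTE vv) /=; field.
  by case: eqVneq => _ /=; field.
- rewrite big_incident_C3_left //= addr0 xk /=.
  exact: (@path_weight_link R k p t r w h (fun i => W (L i)) j k1 t0 (fun=> erefl) WL).
- rewrite big_incident_C3_right //= addr0 xk /=.
  exact: (@path_weight_link R k q t r c f (fun i => W (Q i)) j k1 t0 (fun=> erefl) WQ).
Qed.

(** * Transfer of lower bounds and the comparison *)

(* A nonnegative vector witnessing [r <= spectral_radius R k H]; it transfers
   along isomorphisms and, extended by zero, from a sub-hypergraph. *)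
Definition form_at_least (R : realType) (k : nat) (H : hypergraph) (r : R) : Prop :=
  exists2 y : vertices H -> R, (forall v, 0 <= y v) /\ 0 < \sum_v y v ^+ k &
    r * \sum_v y v ^+ k <= (\sum_(e in edges H) \prod_(w in e) y w) *+ k.

Lemma form_at_least_isomorphic (R : realType) (k : nat) (H G : hypergraph) (r : R) :
  isomorphic H G -> form_at_least k G r -> form_at_least k H r.
Proof.
case=> f bf EG [y [y0 Ny] ry]; have fI := bij_inj bf.
have NE : \sum_v y (f v) ^+ k = \sum_v y v ^+ k.
  by rewrite [RHS](reindex f) //; exact: onW_bij.
have fE : \sum_(e in edges H) \prod_(w in e) y (f w) = \sum_(e in edges G) \prod_(w in e) y w.
  rewrite EG big_imset /=; last by move=> e e' _ _; exact: imset_inj.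
  by apply: eq_bigr => e _; rewrite big_imset //= => z z' _ _; exact: fI.
by exists (y \o f); rewrite /= ?NE ?fE.
Qed.

Lemma form_at_least_sub (R : realType) (k : nat) (H : hypergraph)
    (W : {set vertices H}) (F : {set {set vertices H}}) (r : R) :
  (0 < k)%N -> is_sub W F -> form_at_least k (sub_hypergraph W F) r -> form_at_least k H r.
Proof.
move=> k0 sWF [y [y0 Ny] ry].
have [FE FW] := sWF; pose z v := oapp y 0 (insub v : option {x | x \in W}).
have zval u : z (val u) = y u by rewrite /z valK.
have zout v : v \notin W -> z v = 0 by move=> vW; rewrite /z insubN.
have z0 v : 0 <= z v by rewrite /z; case: insubP => [u _ _|_] /=.
have overW (T : Type) (idx : T) (op : Monoid.com_law idx) (A : {set vertices H}) (g : vertices H -> T) :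
    A \subset W ->
    \big[op/idx]_(v in A) g v = \big[op/idx]_(u in val @^-1: A : {set {x | x \in W}}) g (val u).
  move=> AW; have AE : A = val @: (val @^-1: A : {set {x | x \in W}}).
    apply/setP => v; apply/idP/imsetP => [vA|[u]]; last by rewrite inE => uA ->.
    by exists (Sub v (subsetP AW v vA)); rewrite ?inE.
  by rewrite {1}AE big_imset //= => ? ? _ _; exact: val_inj.
have NE : \sum_v z v ^+ k = \sum_v y v ^+ k.
  rewrite (bigID (fun v => v \in W)) /= [X in _ + X]big1 ?addr0; last first.
    by move=> v vW; rewrite zout // expr0n gtn_eqF.
  rewrite overW //; apply: eq_big => [u|u _]; last by rewrite zval.
  by rewrite inE (valP u).
have fE : \sum_(e in edges (sub_hypergraph W F)) \prod_(w in e) y w =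
    \sum_(e in F) \prod_(w in e) z w.
  rewrite big_imset /=.
    by apply: eq_bigr => e eF; rewrite overW ?FW //; apply: eq_bigr => u _; rewrite zval.
  exact: preimset_val_inj sWF.
exists z; first by rewrite NE.
(* Passing from [F] to all edges of [H] only adds nonnegative products. *)
rewrite NE (le_trans ry) // fE lerMn2r; apply/orP; right.
rewrite [leRHS](bigID (fun e => e \in F)) /= [X in _ <= X + _](_ : _ = \sum_(e in F) \prod_(w in e) z w).
  by rewrite lerDl sumr_ge0 // => e _; exact: prodr_ge0.
by apply: eq_bigl => e; case: (boolP (e \in F)) => [/(subsetP FE) ->|_]; rewrite ?andbF.
Qed.

(** The product equation removes the excess at [v1] and [v2], so the weight vector is a positive
    eigenvector. *)
Lemma spectral_radius_C3_le (R : realType) (k : nat) (u1 u2 v1 v2 : 'I_k) (p q : nat)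
    (t r : R) :
  (3 < k)%N -> uniq [:: u1; u2; v1; v2] -> (0 < p)%N -> (0 < q)%N ->
  1 < t -> 0 < r -> r ^+ k = (t + t^-1) ^+ 2 ->
  path_ratio t p * path_ratio t q = t + t^-1 ->
  spectral_radius R k (C3 u1 u2 v1 v2 p q) <= r.
Proof.
move=> k3 huv p0 q0 t1 r0 rk cc.
have [x x0 xr] := C3_weight_vector k3 huv p0 q0 t1 r0 rk.
move: huv; rewrite /= !inE !negb_or => /and4P[/and3P[uu _ _] _ vv _].
have k2 := ltnW k3; have k1 := ltnW k2; have k0 := ltnW k1.
apply: (spectral_radius_le k0 (uniform_C3 k1 uu vv) (ltW r0) x0) => w.
by rewrite xr cc subrr mulr0 mul0r if_same addr0.
Qed.

(** Summing the vertex equations counts each edge product [k] times, and the product inequality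
    makes the excess at [v1] and [v2] nonnegative. *)
Lemma form_at_least_C3 (R : realType) (k : nat) (u1 u2 v1 v2 : 'I_k) (p q : nat)
    (t r : R) :
  (3 < k)%N -> uniq [:: u1; u2; v1; v2] -> (0 < p)%N -> (0 < q)%N ->
  1 < t -> 0 < r -> r ^+ k = (t + t^-1) ^+ 2 ->
  path_ratio t p * path_ratio t q <= t + t^-1 ->
  form_at_least k (C3 u1 u2 v1 v2 p q) r.
Proof.
move=> k3 huv p0 q0 t1 r0 rk cc.
have [x x0 xr] := C3_weight_vector k3 huv p0 q0 t1 r0 rk.
move: huv; rewrite /= !inE !negb_or => /and4P[/and3P[uu _ _] _ vv _].
have k2 := ltnW k3; have k1 := ltnW k2.
have t0 : 0 < t by apply: lt_trans t1.
exists x.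
  split=> [v|]; first exact: ltW.
  rewrite (bigD1 (inl (inl v1))) //= ltr_pwDl ?exprn_gt0 // sumr_ge0 // => v _.
  by rewrite exprn_ge0 // ltW.
rewrite -(sum_incidences _ (uniform_C3 (p := p) (q := q) k1 uu vv)) mulr_sumr.
apply: ler_sum => w _; rewrite xr lerDl; case: ifP => // _.
have s0 : 0 <= t + t^-1 by rewrite addr_ge0 ?invr_ge0 // ltW.
have c0 : 0 <= path_ratio t p by rewrite ltW // path_ratio_gt0.
by rewrite divr_ge0 // mulr_ge0 ?subr_ge0 // mulr_ge0 // ltW.
Qed.


Local Close Scope ring_scope.

Theorem theorem5p2 (R : realType) (k m p q : nat) (u1 u2 v1 v2 : 'I_k)
    (hk : 4 <= k) (huv : uniq [:: u1; u2; v1; v2])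
    (hp : 0 < p) (hq : 0 < q) (hpq : p + q = m - 1)
    (hdiff : (`|p%:Z - q%:Z| <= 1)%R) :
  in_B3 k m (C3 u1 u2 v1 v2 p q) /\
  (forall G : hypergraph, in_B3 k m G ->
     (spectral_radius R k (C3 u1 u2 v1 v2 p q) <= spectral_radius R k G)%R).
Proof.
(* The subtraction [m - 1] is truncated; positivity of [p] rules out [m = 0]. *)
have mE : m = (p + q).+1 by lia.
have k2 := ltnW hk.
split; first exact: in_B3_C3.
move=> G [[[uG cG _] mG] [W [F [[sWF _ _] [a1 [a2 [b1 [b2 [n1 [n2 [hab n10 n20 iso]]]]]]]]]]].
(* The base has [n1 + n2 + 1] edges, all among the [m] edges of [G]. *)
have n12 : n1 + n2 <= p + q.
  have := isomorphic_card_edges iso; rewrite card_sub_hypergraph_edges //.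
  have := subset_leq_card sWF.1; rewrite mG mE.
  move: hab => /= /and4P[]; rewrite !inE !negb_or => /and3P[? _ _] _ ? _.
  by rewrite card_C3_edges // => mF FE; rewrite FE in mF.
have [t t1 ct] := path_ratio_root R hp hq.
have k0 : 0 < k by lia.
have t0 : (0 < t)%R by apply: lt_trans t1.
have s0 : (0 < t + t^-1)%R by rewrite addr_gt0 ?invr_gt0.
(* This [r] separates the two spectral radii: it is an upper bound for the balanced [C3] and a lower
   bound for [G]. *)
have [r r0 rk] := nth_root_pos_exists k0 (exprn_gt0 2 s0).
apply: (@le_trans _ _ r); first exact: spectral_radius_C3_le ct.
have [y [y0 Ny] ry] : form_at_least k G r.
  apply: form_at_least_sub sWF _ => //; apply: form_at_least_isomorphic iso _.
  apply: form_at_least_C3 rk _ => //; rewrite -ct.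
  by apply: path_ratio_balanced => //; lia.
by apply: spectral_radius_ge Ny ry => //; lia.
Qed.
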